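(* Let $a,b$ be relatively prime integers with $b>a>1$. Suppose that $R=k[x^a,x^b]$ with $k$ a field, and that $R'$ is a one-dimensional analytically irreducible residually rational ring with maximal ideal $\mathfrak{m}=(t^a,t^b)$ for some $t\in\overline{R'}$. Let $I$ and $J$ be non-principal monomial ideals of $R$. Let $I'$ and $J'$ be non-principal monomial ideals of $R'$. Then $$\lambda_R(\mathrm{T}(I\otimes_R J))\geq\tfrac12\mu(I)\mu(J)\quad\text{and}\quad\lambda_{R'}(\mathrm{T}(I'\otimes_{R'}J'))\geq\tfrac12\mu(I')\mu(J').$$
   Context: $\mathrm{T}(M)=\{y\in M: ry=0\text{ for some nonzero }r\in R\}$ is the torsion submodule of a module $M$ over a domain $R$; $\lambda_R$ denotes length as an $R$-module and $\mu(-)$ the minimal number of generators. Local rings are Noetherian; a local ring is analytically irreducible if its completion is a domain, and an analytically irreducible local ring is residually rational if it has the same residue field as its integral closure; $\overline{R'}$ denotes the integral closure of $R'$ in its field of fractions. A monomial ideal of $R$ is one generated by powers of $x$; a monomial ideal of $R'$ is one generated by powers of $t$. *)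

(* Defs.v *)
From HB Require Import structures.
From mathcomp Require Import all_boot all_order all_algebra.
From mathcomp Require Import boolp classical_sets functions constructive_ereal.
From mathcomp.multinomials Require Import freeg.

Set Implicit Arguments.
Unset Strict Implicit.
Unset Printing Implicit Defensive.

Import Order.TTheory GRing.Theory Num.Theory.
Local Open Scope ring_scope.
Local Open Scope quotient_scope.

(** * Submodules, quotient modules, length and number of generators *)

(* A submodule of [M] is a [submodClosed M].  An ideal of [R], proper or not, is
   a submodule of [R^o]; the library's [idealr R] are the proper ideals. *)

Section Submodules.
Variables (R : comNzRingType) (M : lmodType R).

Definition submod_span (G : set M) : {pred M} := fun x =>
  `[< forall N : submodClosed M, (forall g, G g -> g \in N) -> x \in N >].

Lemma submod_span_closed G : GRing.submod_closed (submod_span G).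
Proof.
split; first by apply/asboolP => N _; exact: rpred0.
move=> c x y /asboolP xG /asboolP yG; apply/asboolP => N GN.
by rewrite rpredD ?rpredZ ?xG ?yG.
Qed.

HB.instance Definition _ (G : set M) :=
  GRing.isSubmodClosed.Build R M (submod_span G) (submod_span_closed G).

Definition submodule (N : submodClosed M) : Type := {x : M | x \in N}.

HB.instance Definition _ (N : submodClosed M) := SubChoice.on (submodule N).
HB.instance Definition _ (N : submodClosed M) :=
  [SubChoice_isSubLmodule of submodule N by <:].

Definition submod_pred (N : submodClosed M) : {pred M} := N.

Lemma submod_pred_closed N : zmod_closed (submod_pred N).
Proof.
split=> [|x y]; rewrite /submod_pred; first exact: rpred0.
by move=> xN yN; rewrite -scaleN1r rpredD ?rpredZ.
Qed.

HB.instance Definition _ (N : submodClosed M) :=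
  GRing.isZmodClosed.Build M (submod_pred N) (submod_pred_closed N).

End Submodules.

Section QuotientModule.
Variables (R : comNzRingType) (M : lmodType R) (N : submodClosed M).

Definition quotient_module : Type := Quotient.quot (submod_pred N).

HB.instance Definition _ := GRing.Zmodule.on quotient_module.
HB.instance Definition _ := EqQuotient.on quotient_module.

Definition quotient_scale (c : R) (x : quotient_module) : quotient_module :=
  \pi_quotient_module (c *: repr x).

Lemma quotient_eqP (x y : M) :
  \pi_quotient_module x = \pi_quotient_module y <-> x - y \in N.
Proof.
rewrite -[_ \in N]/(_ \in submod_pred N) (Quotient.idealrBE (submod_pred N)).
by split=> [->|/eqP].
Qed.

Lemma quotient_piD : {morph \pi_quotient_module : x y / x + y}.
Proof. by move=> x y; exact (Quotient.pi_add (submod_pred N) x y). Qed.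

Lemma quotient_piZ c x :
  quotient_scale c (\pi_quotient_module x) = \pi_quotient_module (c *: x).
Proof.
apply/quotient_eqP; rewrite -scalerBr rpredZ //.
by apply/quotient_eqP; rewrite reprK.
Qed.

Lemma quotient_scaleA a b x :
  quotient_scale a (quotient_scale b x) = quotient_scale (a * b) x.
Proof. by elim/quotW: x => x; rewrite (quotient_piZ b) !quotient_piZ scalerA. Qed.

Lemma quotient_scale1 : left_id 1 quotient_scale.
Proof. by elim/quotW => x; rewrite quotient_piZ scale1r. Qed.

Lemma quotient_scaleDr : right_distributive quotient_scale +%R.
Proof.
move=> a; elim/quotW => x; elim/quotW => y.
by rewrite -quotient_piD !quotient_piZ scalerDr quotient_piD.
Qed.

Lemma quotient_scaleDl x : {morph quotient_scale^~ x : a b / a + b}.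
Proof.
by move=> a b; elim/quotW: x => x; rewrite !quotient_piZ scalerDl quotient_piD.
Qed.

HB.instance Definition _ := GRing.Zmodule_isLmodule.Build R quotient_module
  quotient_scaleA quotient_scale1 quotient_scaleDr quotient_scaleDl.

End QuotientModule.

Definition strictly_increasing (T : Type) (n : nat) (N : nat -> {pred T}) :=
  forall i, (i < n)%N ->
    {subset N i <= N i.+1} /\ ~ {subset N i.+1 <= N i}.

(* Lengths, dimensions and numbers of generators are naturals or +oo; they are
   taken in [\bar rat] so that they can be multiplied by 1/2. *)
Definition nat_sup (A : set nat) : \bar rat :=
  supremum -oo%E [set (n%:R : rat)%:E | n in A]%classic.

Definition nat_inf (A : set nat) : \bar rat :=
  infimum +oo%E [set (n%:R : rat)%:E | n in A]%classic.

Section Invariants.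
Variables (R : comNzRingType) (M : lmodType R).

Definition module_length : \bar rat :=
  nat_sup (fun n => exists N : nat -> submodClosed M, strictly_increasing n N).

Definition mu : \bar rat :=
  nat_inf (fun n => exists2 s : seq M, size s = n &
    forall x : M, x \in submod_span [set` s]%classic).

End Invariants.

Arguments module_length {R} M.
Arguments mu {R} M.

(** * Tensor products and torsion *)

Section Tensor.
Variables (R : comNzRingType) (M N : lmodType R).

Let free := {freeg (M * N)%type / R}.
Let pure (x : M) (y : N) : free := Freeg [:: (1, (x, y))].

Definition tensor_relations : set free := fun g =>
  [\/ exists x x' y, g = pure (x + x') y - (pure x y + pure x' y),
      exists x y y', g = pure x (y + y') - (pure x y + pure x y'),
      exists c x y, g = pure (c *: x) y - c *: pure x y
    | exists c x y, g = pure x (c *: y) - c *: pure x y].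

Definition tensor : lmodType R := quotient_module (submod_span tensor_relations).

End Tensor.

Section Torsion.
Variables (R : idomainType) (M : lmodType R).

Definition torsion : {pred M} := fun y => `[< exists2 r : R, r != 0 & r *: y = 0 >].

Lemma torsion_submod_closed : GRing.submod_closed torsion.
Proof.
split; first by apply/asboolP; exists 1; rewrite ?oner_eq0 ?scaler0.
move=> c x y /asboolP[r r0 rx] /asboolP[s s0 sy]; apply/asboolP.
exists (r * s); first by rewrite mulf_neq0.
rewrite scalerDr -[(r * s) *: y]scalerA sy scaler0 addr0 scalerA.
by rewrite mulrC mulrA [c * r * s]mulrAC -scalerA rx scaler0.
Qed.

HB.instance Definition _ :=
  GRing.isSubmodClosed.Build R M torsion torsion_submod_closed.

End Torsion.

Arguments torsion {R} M.

(** * Ideals *)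

Section Ideals.
Variable R : comNzRingType.

Definition principal (I : submodClosed R^o) :=
  exists g : R^o, I =i submod_span [set g]%classic.

(* The ideal [I ^ n]; for [n = 0] it is the unit ideal. *)
Definition ideal_pow (I : {pred R}) (n : nat) : submodClosed R^o :=
  submod_span (fun x : R^o => exists2 f : 'I_n -> R,
    (forall i, f i \in I) & x = \prod_(i < n) f i).

Lemma ideal_pow_closed (I : {pred R}) n :
  0 \in ideal_pow I n /\ forall c x y : R,
    x \in ideal_pow I n -> y \in ideal_pow I n -> c * x + y \in ideal_pow I n.
Proof.
have [P0 PL] := submod_span_closed (fun x : R^o => exists2 f : 'I_n -> R,
    (forall i, f i \in I) & x = \prod_(i < n) f i).
by split=> // c x y; exact: PL.
Qed.

(* [I] is generated by powers of [t], where [t] lies in an extension [phi] of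
   [R]. *)
Definition monomial_ideal (K : nzRingType) (phi : R -> K) (t : K)
    (I : submodClosed R^o) :=
  exists2 G : set R^o, (forall g, G g -> exists n, phi g = t ^+ n) &
    I =i submod_span G.

Definition maximal_ideal (m : idealr R) :=
  forall J : idealr R, {subset m <= J} -> {subset J <= m}.

Definition noetherian :=
  forall I : submodClosed R^o, exists s : seq R^o, I =i submod_span [set` s]%classic.

Definition local_ring (m : idealr R) :=
  [/\ noetherian, maximal_ideal m &
      forall n : idealr R, maximal_ideal n -> n =i m].

Definition krull_dim : \bar rat :=
  nat_sup (fun n => exists P : nat -> prime_idealr R, strictly_increasing n P).

End Ideals.

(** * The [m]-adic completion *)

(* The inverse limit of the [R / m ^ n]: sequences of representatives [u n] of
   compatible classes modulo [m ^ n], up to equality of all these classes. *)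
Section Completion.
Variables (R : comNzRingType) (m : idealr R).

Definition coherent : {pred nat -> R} := fun u =>
  `[< forall n, u n.+1 - u n \in ideal_pow m n >].

Lemma coherent_subring_closed : subring_closed coherent.
Proof.
have [P0 PL] := all_and2 (ideal_pow_closed m).
split=> [|u v|u v].
- by apply/asboolP => n; rewrite subrr.
- move=> /asboolP uP /asboolP vP; apply/asboolP => n.
  rewrite -[X in X \in _]/(u n.+1 - v n.+1 - (u n - v n)).
  rewrite opprB addrACA [- v _ - _]addrC addrACA -[v n - _]opprB addrC.
  rewrite -[- (_ - _)]mulN1r.
  exact: PL.
move=> /asboolP uP /asboolP vP; apply/asboolP => n.
rewrite -[X in X \in _]/(u n.+1 * v n.+1 - u n * v n).
have -> : u n.+1 * v n.+1 - u n * v n =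
    u n.+1 * (v n.+1 - v n) + (v n * (u n.+1 - u n) + 0).
  by rewrite addr0 !mulrBr addrA [v n * _]mulrC subrK [v n * _]mulrC.
by apply: (PL n) => //; exact: (PL n).
Qed.

HB.instance Definition _ :=
  GRing.isSubringClosed.Build (nat -> R) coherent coherent_subring_closed.

Definition coherent_seq : Type := {u : nat -> R | u \in coherent}.

HB.instance Definition _ := SubChoice.on coherent_seq.
HB.instance Definition _ := [SubChoice_isSubComNzRing of coherent_seq by <:].

Definition null_seq : {pred coherent_seq} := fun u =>
  `[< forall n, val u n \in ideal_pow m n >].

Lemma ideal_pow1_sub : {subset ideal_pow m 1 <= m}.
Proof.
have mP : GRing.submod_closed (m : {pred R^o}).
  by split=> [|c x y xm ym]; rewrite ?idealr0 ?rpredD ?idealMr.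
pose N : submodClosed R^o := HB.pack (m : {pred R^o})
  (GRing.isSubmodClosed.Build R R^o (m : {pred R^o}) mP).
move=> x /asboolP /(_ N); apply=> _ [f fm ->].
by rewrite big_ord1; exact: fm.
Qed.

Lemma null_seq_ideal : idealr_closed null_seq.
Proof.
have [P0 PL] := all_and2 (ideal_pow_closed m).
split; first by apply/asboolP => n; exact: P0.
- apply/negP => /asboolP /(_ 1%N) /ideal_pow1_sub.
  by rewrite [val _ _]/(1 : R) idealr1.
move=> a u v /asboolP uP /asboolP vP; apply/asboolP => n.
rewrite [val _ _]/(val a n * val u n + val v n).
by apply: PL; [exact: (uP n)|exact: (vP n)].
Qed.

HB.instance Definition _ := isIdealr.Build coherent_seq null_seq null_seq_ideal.

Definition completion : comNzRingType := {ideal_quot null_seq}.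

End Completion.

Definition analytically_irreducible (R : comNzRingType) (m : idealr R) :=
  local_ring m /\ GRing.integral_domain_axiom (completion m).

(** * The integral closure in the field of fractions *)

Section IntegralClosure.
Variable R : idomainType.

Definition integral : {pred {fraction R}} :=
  fun z => `[< integralOver (@tofrac R) z >].

Lemma integral_subring_closed : subring_closed integral.
Proof.
split=> [|x y|x y]; first by apply/asboolP; exact: integral1.
- by move=> /asboolP xi /asboolP yi; apply/asboolP; exact: integral_sub.
by move=> /asboolP xi /asboolP yi; apply/asboolP; exact: integral_mul.
Qed.

HB.instance Definition _ :=
  GRing.isSubringClosed.Build {fraction R} integral integral_subring_closed.

Definition integral_closure : Type := {z : {fraction R} | z \in integral}.

HB.instance Definition _ := SubChoice.on integral_closure.
HB.instance Definition _ :=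
  [SubChoice_isSubComNzRing of integral_closure by <:].

Lemma tofrac_integral (x : R) : tofrac x \in integral.
Proof. by apply/asboolP; exact: integral_id. Qed.

Definition to_closure (x : R) : integral_closure := Sub (tofrac x) (tofrac_integral x).

(* The inclusion of [R] in its integral closure induces an isomorphism of
   residue fields.  When [R] is analytically irreducible its integral closure is
   local, so there is exactly one [n] to consider. *)
Definition residually_rational (m : idealr R) :=
  forall n : idealr integral_closure, maximal_ideal n ->
  exists2 f : {rmorphism {ideal_quot m} -> {ideal_quot n}}, bijective f &
    forall x : R,
      f (\pi_{ideal_quot m} x) = \pi_{ideal_quot n} (to_closure x).

End IntegralClosure.

Arguments integral_closure : clear implicits.

(** * The ring [k[x^a, x^b]] *)

Section SemigroupRing.
Variables (k : fieldType) (a b : nat).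

Definition subalg_gen : {pred {poly k}} := fun p =>
  `[< forall S : {pred {poly k}}, GRing.subalg_closed S ->
        'X^a \in S -> 'X^b \in S -> p \in S >].

Lemma subalg_gen_closed : GRing.subalg_closed subalg_gen.
Proof.
split; first by apply/asboolP => S [].
- move=> c p q /asboolP pP /asboolP qP; apply/asboolP => S SP Sa Sb.
  by have [_ SL _] := SP; apply: SL; [exact: pP|exact: qP].
move=> p q /asboolP pP /asboolP qP; apply/asboolP => S SP Sa Sb.
by have [_ _ SM] := SP; apply: SM; [exact: pP|exact: qP].
Qed.

(* Non-units are their own inverse in the library, and units of [{poly k}] are
   constants. *)
Lemma subalg_gen_divring : divring_closed subalg_gen.
Proof.
have [S1 SL SM] := subalg_gen_closed.
have SC c : c%:P \in subalg_gen.
  have S0 : 0 \in subalg_gen by rewrite -(addNr 1) -scaleN1r SL.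
  by rewrite -alg_polyC -[_ *: _]addr0 SL.
split=> // [p q pS qS|p q pS qS]; first by rewrite -scaleN1r addrC SL.
apply: SM => //; have [|qN] := boolP (q \is a GRing.unit); last by rewrite invr_out.
rewrite poly_unitE => /andP[/size_poly1P[c c0 ->] _].
by rewrite polyCV SC.
Qed.

HB.instance Definition _ :=
  GRing.isDivringClosed.Build {poly k} subalg_gen subalg_gen_divring.

Definition semigroup_ring : Type := {p : {poly k} | p \in subalg_gen}.

HB.instance Definition _ := SubChoice.on semigroup_ring.
HB.instance Definition _ :=
  [SubChoice_isSubIntegralDomain of semigroup_ring by <:].

End SemigroupRing.

(* Main.v *)
Require Import Defs.
From HB Require Import structures.
From mathcomp Require Import all_boot all_order all_algebra.
From mathcomp Require Import boolp classical_sets functions constructive_ereal.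
From mathcomp.multinomials Require Import freeg.
From mathcomp Require Import zify.

(** Let H be the numerical semigroup generated by a and b.  A monomial ideal is
    the span of the x^e for e in a set E of elements of H with E + H inside E.
    Let I and J have exponent sets E and F.  For a degree d, the pure tensors
    x^e ⊗ x^(d - e) are indexed by the fiber of d, the set of e in E with
    d - e in F; moving a factor x^a or x^b across the tensor sign identifies
    the tensors of e and e + a, or e and e + b, when both indices are in the
    fiber.  All the tensors of degree d have the same image x^d in IJ, so the
    difference of two of them is torsion.  It does not vanish when its two
    indices lie in different connected components of the fiber.

    Non-vanishing is detected by a linear map ([fiber_functional]).  If C is a
    union of components of the fiber of d, write an element of I as x1 + x2,
    where the exponents of x1 lie in C or outside the fiber, and those of x2
    lie outside C; then x1 is determined up to exponents outside the fiber.
    Hence (x, y) |-> x1 * y is well defined modulo the monomials x^n with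
    d - n not in H.  This map separates tensors of degree d indexed inside and
    outside C and kills all tensors of larger degree.  Listing torsion elements
    by decreasing degree thus gives a strictly increasing chain of submodules:
    the length of the torsion is at least the number of independent splittings
    of fibers ([torsion_length_monomial]).

    It remains to find at least half as many splittings as there are pairs
    (e, f) of minimal generators of E and F ([splitting_family]).  Put E on a
    cylinder, the classes modulo a being visited by adding b.  The minimum
    of E in the class of e + k b is e + k b until k reaches the gap of e, where
    the next generator takes over.  With del + 1 the smaller of the two gaps of
    e and f, the points e + k b for k <= del form a whole component of the fiber
    of e + f + del b, and different pairs give different components.  Pairs
    are grouped by the class of this degree modulo a.  In a group of v >= 2
    pairs, the pair of least degree provides a second point for the v - 1 other
    fibers, and v - 1 >= v / 2.  For a pair alone in its group, a fiber of the
    same class is cut along the arc of classes that belong to one generator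
    ([arc_splits]).

    The argument uses two facts about the ring: the intersection of two spans
    of monomials is the span of the common monomials, and a monomial lies in
    such a span only if it is one of its generators ([monomials]).  In
    k[x^a, x^b] both are read off the supports of polynomials.  In the local
    ring every element has leading terms with coefficient a unit, and a unit
    multiple of t^n is never an R-combination of higher powers of t: otherwise
    t, hence t^a, would have an integral inverse, whereas t^a lies in the
    maximal ideal ([leading_unit]). *)

Set Implicit Arguments.
Unset Strict Implicit.
Unset Printing Implicit Defensive.

Import Order.TTheory GRing.Theory Num.Theory.
Local Open Scope ring_scope.

(** * Fibers of the sum of two exponent sets *)

Section Staircases.
Local Open Scope nat_scope.
Variables a b : nat.
Hypotheses (a_gt1 : 1 < a) (a_lt_b : a < b) (coprime_ab : coprime a b).

Definition sgp (n : nat) : bool :=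
  `[< exists p q, n = p * a + q * b >].

Lemma sgpP n : reflect (exists p q, n = p * a + q * b) (sgp n).
Proof. exact: asboolP. Qed.

Lemma mulb_residue n : exists2 k, k < a & k * b = n %[mod a].
Proof.
have b_gt0 : 0 < b by lia.
have cba : coprime b a by rewrite coprime_sym.
have /(coprimeP _ b_gt0)[[u v] /= uv1] := cba.
exists ((u * n) %% a); first by rewrite ltn_mod; lia.
have uv : u * b = 1 + v * a by lia.
rewrite modnMml mulnAC uv mulnDl mul1n mulnAC.
by rewrite addnC modnMDl.
Qed.

Lemma sgp_conductor n : a * b <= n -> sgp n.
Proof.
move=> n_ge; have [k k_lt /eqP kn] := mulb_residue n.
have kb : k * b <= n by apply: leq_trans n_ge; rewrite leq_mul2r ltnW ?orbT.
move: kn; rewrite eq_sym (eqn_mod_dvd _ kb) => /dvdnP[p np].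
by apply/sgpP; exists p, k; lia.
Qed.

Definition hclosed (E : pred nat) := forall n, E n -> E (n + a) /\ E (n + b).

Lemma hclosed_iter E n p q : hclosed E -> E n -> E (n + p * a + q * b).
Proof.
move=> EH En; elim: q => [|q IHq]; last first.
  by rewrite mulSn addnCA addnC; have [] := EH _ IHq.
rewrite addn0; elim: p => [|p IHp]; first by rewrite addn0.
by rewrite mulSn addnCA addnC; have [] := EH _ IHp.
Qed.

Lemma hclosed_iter_eq E n p q m :
  hclosed E -> E n -> m = n + p * a + q * b -> E m.
Proof. by move=> EH En ->; exact: hclosed_iter. Qed.

Lemma hclosed_sgp E n h : hclosed E -> E n -> sgp h -> E (n + h).
Proof.
by move=> EH En /sgpP[p [q ->]]; rewrite addnA; exact: hclosed_iter.
Qed.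

Definition gen (E : pred nat) g :=
  [&& E g, ~~ ((a <= g) && E (g - a)) & ~~ ((b <= g) && E (g - b))].

Lemma gen_minimal E g p q n : hclosed E -> gen E g -> E n ->
  n + p * a + q * b = g -> p = 0 /\ q = 0.
Proof.
move=> EH /and3P[Eg ga gb] En ng; split.
  case: p ng => // p ng; case/negP: ga; apply/andP; split; first by nia.
  by apply: (hclosed_iter_eq (n := n) (p := p) (q := q)) => //; lia.
case: q ng => // q ng; case/negP: gb; apply/andP; split; first by nia.
by apply: (hclosed_iter_eq (n := n) (p := p) (q := q)) => //; lia.
Qed.

Lemma gap_ex E e : hclosed E -> E e -> exists k, (0 < k) && E (e + k * b - a).
Proof.
move=> EH Ee; exists a; apply/andP; split; first by lia.
apply: (hclosed_iter_eq (n := e) (p := b.-1) (q := 0)) => //.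
have -> : b = b.-1 + 1 by lia.
nia.
Qed.

Lemma gen_decomp (E : pred nat) n : E n -> exists g h, [/\ gen E g, sgp h & n = g + h].
Proof.
elim/ltn_ind: n => n IHn En.
have [nG|] := boolP (gen E n).
  by exists n, 0; split; rewrite ?addn0 //; apply/sgpP; exists 0, 0.
rewrite /gen En -negb_or negbK => /orP[] /andP[le En'].
  have [|g [h [gG /sgpP[p [q hE]] nE]]] := IHn _ _ En'; first by lia.
  by exists g, (h + a); split => //; [apply/sgpP; exists p.+1, q; lia|lia].
have [|g [h [gG /sgpP[p [q hE]] nE]]] := IHn _ _ En'; first by lia.
by exists g, (h + b); split => //; [apply/sgpP; exists p, q.+1; lia|lia].
Qed.

Lemma gens_finite (E : pred nat) e : hclosed E -> E e ->
  exists2 s : seq nat, uniq s & forall g, (g \in s) = gen E g.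
Proof.
move=> EH Ee; exists [seq g <- iota 0 (e + a * b + a) | gen E g].
  by rewrite filter_uniq // iota_uniq.
move=> g; rewrite mem_filter mem_iota /= add0n.
case gG: (gen E g) => //=; rewrite ltnNge; apply/negP => le.
have /and3P[_ /negP + _] := gG; apply; apply/andP; split; first by lia.
have -> : g - a = e + (g - a - e) by lia.
by apply: hclosed_sgp => //; apply: sgp_conductor; lia.
Qed.

(** Among the classes of e, e + b, e + 2 b, ... modulo a, the minimum of E in the
    class of e + k b stays e + k b exactly as long as k < G; in class G it is
    smaller by at least a. *)
Definition gap_spec (E : pred nat) e G :=
  [/\ 0 < G, G < a, E (e + G * b - a) &
      forall k, 0 < k -> k < G -> ~~ E (e + k * b - a)].

Definition nonprincipal (E : pred nat) :=
  forall g, E g -> exists2 n, E n & ~~ ((g <= n) && sgp (n - g)).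

(** A gap equal to a would make e + k b the minimum of E in every class modulo
    a, so that E = e + H would be generated by e. *)
Lemma gapP E e : hclosed E -> nonprincipal E -> gen E e ->
  exists G, gap_spec E e G.
Proof.
move=> EH npE eG; have Ee : E e by case/and3P: eG.
case: (ex_minnP (gap_ex EH Ee)) => G /andP[G_gt0 EG] Gmin.
exists G; split => //; last first.
  move=> k k0 kG; apply/negP => Ek; have := Gmin k; rewrite k0 Ek => /(_ isT).
  by rewrite leqNgt kG.
rewrite ltnNge; apply/negP => aG.
have [n En /negP[]] := npE e Ee.
(* Modulo a, the factor a.-1 is -1: k b is congruent to n - e. *)
have [k k_lt kn] := mulb_residue (n + e * (a.-1)).
have kne : e + k * b = n %[mod a].
  rewrite -modnDmr kn modnDmr.
  have -> : e + (n + e * a.-1) = e * a + n by nia.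
  by rewrite modnMDl.
have [le|lt] := leqP (e + k * b) n.
  move/eqP: kne; rewrite eq_sym (eqn_mod_dvd _ le) => /dvdnP[p np].
  by apply/andP; split; [lia|apply/sgpP; exists p, k; lia].
move/eqP: kne; rewrite (eqn_mod_dvd _ (ltnW lt)) => /dvdnP[p np].
case: p np => [|p] np; first by lia.
case: k => [|k] in k_lt kn lt np.
  have := gen_minimal (p := p.+1) (q := 0) EH eG En.
  by case; lia.
suff : G <= k.+1 by lia.
apply: Gmin; apply/andP; split => //.
by apply: (hclosed_iter_eq (n := n) (p := p) (q := 0)) => //; lia.
Qed.

Definition fiber (E F : pred nat) d e := [&& E e, e <= d & F (d - e)].

(** C is a union of connected components of the fiber of d, for the graph whose
    edges join e to e + a and to e + b. *)
Definition separates E F d (C : pred nat) :=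
  [/\ forall e, C e -> fiber E F d e,
      forall e, fiber E F d e -> fiber E F d (e + a) -> C e = C (e + a) &
      forall e, fiber E F d e -> fiber E F d (e + b) -> C e = C (e + b)].

Definition splits E F d e1 e2 (C : pred nat) :=
  [/\ fiber E F d e1, fiber E F d e2, C e1, ~~ C e2 & separates E F d C].

(** Exchanging E and F reflects the fiber of d by e |-> d - e. *)
Lemma splits_swap E F d e1 e2 C : splits E F d e1 e2 C ->
  splits F E d (d - e1) (d - e2) (fun x => (x <= d) && C (d - x)).
Proof.
have fs x : fiber F E d x -> fiber E F d (d - x).
  by move=> /and3P[? ? ?]; apply/and3P; split; rewrite ?leq_subr ?subKn.
have fs' x : x <= d -> fiber E F d (d - x) -> fiber F E d x.
  by move=> ? /and3P[? ? ?]; apply/and3P; split => //; rewrite -[x](@subKn _ d).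
move=> [S1 S2 C1 C2 [CS Ca Cb]].
have le1 : e1 <= d by case/and3P: S1.
have le2 : e2 <= d by case/and3P: S2.
split; rewrite ?leq_subr ?subKn //.
- by apply: fs'; rewrite ?leq_subr ?subKn.
- by apply: fs'; rewrite ?leq_subr ?subKn.
split=> [x /andP[xd Cx]|x Sx Sxa|x Sx Sxb].
- by apply: fs' => //; exact: CS.
- have /and3P[_ lea _] := Sxa; have lex : x <= d by lia.
  rewrite lea lex /=; have -> : d - x = d - (x + a) + a by lia.
  apply/esym/Ca; first exact: fs.
  by have -> : d - (x + a) + a = d - x; [lia|exact: fs].
have /and3P[_ lea _] := Sxb; have lex : x <= d by lia.
rewrite lea lex /=; have -> : d - x = d - (x + b) + b by lia.
apply/esym/Cb; first exact: fs.
by have -> : d - (x + b) + b = d - x; [lia|exact: fs].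
Qed.

Section Strips.
Variables E : pred nat.
Hypothesis EH : hclosed E.

Definition strip (e del : nat) : pred nat :=
  fun x => [exists k : 'I_del.+1, x == e + k * b].

Lemma stripP e del x : reflect (exists2 k, k <= del & x = e + k * b) (strip e del x).
Proof.
apply: (iffP existsP) => [[k /eqP ->]|[k kdel ->]].
  by exists k => //; rewrite -ltnS.
by exists (inord k); rewrite inordK.
Qed.

(** Below the gap the point e + k b is minimal in its class: an element of E can
    reach it only through steps b. *)
Lemma gap_minimal e G k n p q : gen E e -> gap_spec E e G -> k < G -> E n ->
  n + p * a + q * b = e + k * b -> p = 0.
Proof.
move=> eG [_ _ _ Gk] kG En npq; case: p npq => // p npq.
case: k kG npq => [|k] kG npq.
  have [|] // := gen_minimal (p := p.+1) (q := q) EH eG En; first by lia.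
case/negP: (Gk k.+1 isT kG).
by apply: (hclosed_iter_eq (n := n) (p := p) (q := q)) => //; lia.
Qed.

End Strips.

Section Family.
Variables E F : pred nat.
Hypotheses (EH : hclosed E) (FH : hclosed F).
Hypotheses (npE : nonprincipal E) (npF : nonprincipal F).

Section OnePair.
Variables e f G D del d : nat.
Hypotheses (eG : gen E e) (fG : gen F f).
Hypotheses (gapE : gap_spec E e G) (gapF : gap_spec F f D).
Hypotheses (delG : del < G) (delD : del < D).
Hypothesis dE : d = e + f + del * b.

Lemma strip_fiber x : strip e del x -> fiber E F d x.
Proof.
have Ee : E e by case/and3P: eG.
have Ff : F f by case/and3P: fG.
case/stripP=> k kdel ->; apply/and3P; split.
- by apply: (hclosed_iter_eq (n := e) (p := 0) (q := k)) => //; lia.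
- by rewrite dE; nia.
by apply: (hclosed_iter_eq (n := f) (p := 0) (q := del - k)) => //; rewrite dE; nia.
Qed.

Lemma strip_subL k n p q : k <= del -> E n ->
  n + p * a + q * b = e + k * b -> p = 0.
Proof. by move=> kdel; apply: (gap_minimal EH eG gapE); lia. Qed.

Lemma strip_subR k n p q : k <= del -> F n ->
  n + p * a + q * b = f + k * b -> p = 0.
Proof. by move=> kdel; apply: (gap_minimal FH fG gapF); lia. Qed.

(** The strip is closed under neighbours.  A step of a leaves it upwards only by
    lowering the F-side below its class minimum, and downwards by doing so on the
    E-side; a step of b past either end would contradict the minimality of the
    generator f or e. *)
Lemma strip_separates : separates E F d (strip e del).
Proof.
split=> [x|x|x]; first exact: strip_fiber.
- move=> /and3P[Ex xd Fx] /and3P[Exa xad Fxa].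
  apply/stripP/stripP => -[k kdel kx].
    have H := @strip_subR (del - k) (d - (x + a)) 1 0 _ Fxa.
    by suff: 1 = 0 by []; apply: H; nia.
  by have : 1 = 0 by apply: (@strip_subL k x 1 0); lia.
move=> /and3P[Ex xd Fx] /and3P[Exb xbd Fxb].
apply/stripP/stripP => -[k kdel kx].
  exists k.+1; last by lia.
  rewrite ltn_neqAle kdel andbT; apply/eqP => keq.
  have [|_] // := gen_minimal (p := 0) (q := 1) FH fG Fxb.
  by rewrite dE kx keq in xbd *; lia.
case: k => [|k] in kdel kx *.
  by have [|_] // := gen_minimal (p := 0) (q := 1) EH eG Ex; lia.
by exists k; lia.
Qed.

(** When G is the gap of e, this is the part of E in the classes of e, e + b, ...,
    e + (G - 1) b modulo a, those whose minimum comes from the generator e. *)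
Definition arc (e G : nat) : pred nat :=
  fun x => `[< exists k p, k < G /\ x = e + k * b + p * a >].

Lemma arcP e' G' x :
  reflect (exists k p, k < G' /\ x = e' + k * b + p * a) (arc e' G' x).
Proof. exact: asboolP. Qed.

Lemma next_notin_arc : ~~ arc e G (e + G * b - a).
Proof.
have [G_gt0 Ga _ _] := gapE.
apply/negP => /arcP[k [p [kG kp]]].
have : G * b = k * b %[mod a].
  apply/eqP; rewrite eqn_mod_dvd; last by rewrite leq_mul2r (ltnW kG) orbT.
  by apply/dvdnP; exists p.+1; clear -kp a_gt1 a_lt_b G_gt0 kG; nia.
move/eqP; rewrite eqn_mod_dvd ?leq_mul2r ?(ltnW kG) ?orbT //.
rewrite -mulnBl Gauss_dvdl // => /dvdn_leq.
by clear -Ga G_gt0 kG; lia.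
Qed.

(** The next generator after e lies outside the arc, and F meets every class
    modulo a. *)
Lemma outside_arc_ex : exists e1 f1,
  [/\ E e1, F f1, ~~ arc e G e1 & e1 + f1 = d %[mod a]].
Proof.
have [_ _ EG _] := gapE.
set e1 := e + G * b - a in EG *.
(* Modulo a, the factor a.-1 is -1: k b is congruent to d - e1 - f. *)
have [k k_lt kd] := mulb_residue (d + (e1 + f) * a.-1).
exists e1, (f + k * b); split => //; last 1 first.
- rewrite addnA -modnDmr kd modnDmr.
  have -> : e1 + f + (d + (e1 + f) * a.-1) = (e1 + f) * a + d.
    by clearbody e1; clear -a_gt1; nia.
  by rewrite modnMDl.
- apply: (hclosed_iter_eq (n := f) (p := 0) (q := k)) => //; first by case/and3P: fG.
  by rewrite mul0n addn0.
exact: next_notin_arc.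
Qed.

(** A component can leave the arc only across one of its two end classes.  A step
    of b up from the last class reaches e + G b + p a; subtracting a gives a point
    of E outside the arc, hence a pair of degree less than d'.  By minimality
    this leaves d' = d, where the step contradicts that f is a generator.  A step
    of b down from the first class gives a point outside the arc, which is paired
    with the next element f + D b - a of F; the minimality of d' then bounds u so
    that the step goes below the class minimum f + del b. *)
Lemma arc_separates u d' : del.+1 = D -> D <= G -> d' = d + u * a ->
  (u = 0 \/ forall e' f', E e' -> F f' -> ~~ arc e G e' ->
     e' + f' = d %[mod a] -> d' <= e' + f') ->
  separates E F d' (fun x => fiber E F d' x && arc e G x).
Proof.
move=> delDE DG d'u minQ; have [G_gt0 Ga EG _] := gapE; have [_ _ FD _] := gapF.
split=> [x /andP[]//|x Sx Sxa|x Sx Sxb]; have /and3P[Ex xd Fx] := Sx.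
  rewrite Sx Sxa /=; apply/arcP/arcP => -[k [p [kG xE]]].
    by exists k, p.+1; clear -kG xE; lia.
  case: p => [|p] in xE *; last by exists k, p; clear -kG xE; lia.
  have := gap_minimal (p := 1) (q := 0) EH eG gapE kG Ex.
  by clear -xE; lia.
rewrite Sx Sxb /=; have /and3P[Exb xbd Fxb] := Sxb.
apply/idP/idP => [/arcP[k [p [kG xE]]]|].
  apply/arcP; have [kG1|Gk] := ltnP k.+1 G.
    by exists k.+1, p; clear -kG1 xE; lia.
  exfalso; have kE : G = k.+1 by clear -kG Gk; lia.
  have sumE : e + G * b - a + (d' - (x + b)) + p.+1 * a = d'.
    by clear -kE xE xbd a_lt_b; subst; lia.
  have u0 : u = 0.
    case: minQ => // minQ.
    have /minQ-/(_ _ Fxb next_notin_arc) := EG.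
    suff -> : e + G * b - a + (d' - (x + b)) = d %[mod a].
      by move/(_ erefl); clear -sumE a_gt1; lia.
    have : d' = d %[mod a] by rewrite d'u addnC modnMDl.
    by move=> <-; rewrite -[in RHS]sumE [in RHS]addnC modnMDl.
  have gd : (G - del) * b + del * b = G * b.
    by rewrite -mulnDl subnK //; clear -delG; lia.
  have := gen_minimal (p := p) (q := G - del) FH fG Fxb.
  have {}d'u : d' = e + f + del * b by rewrite d'u u0 dE; clear; lia.
  by clear -d'u kE xE xbd gd delG; subst G; case; lia.
move=> /arcP[k [p [kG xE]]].
case: k => [|k] in kG xE *; last by apply/arcP; exists k, p; clear -kG xE; lia.
apply/negPn/negP => Nx.
case: p => [|p] in xE *.
  have := gen_minimal (p := 0) (q := 1) EH eG Ex.
  by clear -xE; case; lia.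
have up : u <= p.
  case: minQ => [->//|/(_ _ _ Ex FD Nx)].
  have -> : x + (f + D * b - a) = p * a + d.
    by clear -xE dE delDE a_lt_b; subst; lia.
  rewrite modnMDl => /(_ erefl).
  by clear -d'u a_gt1; rewrite d'u addnC leq_add2r leq_pmul2r //; lia.
have := gap_minimal (p := (p - u).+1) (q := 0) FH fG gapF delD Fxb.
have : (p - u) * a + u * a = p * a by rewrite -mulnDl subnK.
by clear -xE xbd dE d'u; subst; lia.
Qed.

(** The degree is the larger of d and of the least degree d1, in the class of d,
    of a pair whose first entry lies outside the arc.  Both kinds of points then
    occur in the fiber, and it is still too small to connect them. *)
Lemma arc_splits : del.+1 = D -> D <= G ->
  exists d' e2 C, splits E F d' e e2 C /\ d' = d %[mod a].
Proof.
move=> delDE DG.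
have Ee : E e by case/and3P: eG.
have Ff : F f by case/and3P: fG.
have [G_gt0 Ga EG _] := gapE.
pose Q d1 := `[< exists e1 f1, [/\ E e1, F f1, ~~ arc e G e1,
  e1 + f1 = d %[mod a] & d1 = e1 + f1] >].
have exQ : exists d1, Q d1.
  have [e1 [f1 [Ee1 Ff1 Ne1 ef]]] := outside_arc_ex.
  by exists (e1 + f1); apply/asboolP; exists e1, f1.
case: (ex_minnP exQ) => d1 /asboolP[e1 [f1 [Ee1 Ff1 Ne1 d1d d1E]]] d1min.
have minQ e' f' : E e' -> F f' -> ~~ arc e G e' ->
    e' + f' = d %[mod a] -> d1 <= e' + f'.
  by move=> Ee' Ff' Ne' ef'; apply: d1min; apply/asboolP; exists e', f'.
have [d' [u [w [d'u d'w uw]]]] : exists d' u w,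
    [/\ d' = d + u * a, d' = d1 + w * a & u = 0 \/ d' = d1].
  have [le|lt] := leqP d1 d.
    move/eqP: d1d; rewrite -d1E eq_sym eqn_mod_dvd // => /dvdnP[w wE].
    by exists d, 0, w; split; [clear; lia|clear -wE le; lia|left].
  move/eqP: d1d; rewrite -d1E eqn_mod_dvd 1?ltnW // => /dvdnP[u uE].
  by exists d1, u, 0; split; [clear -uE lt; lia|clear; lia|right].
exists d', e1, (fun x => fiber E F d' x && arc e G x).
split; last by rewrite d'u addnC modnMDl.
have Se : fiber E F d' e.
  apply/and3P; split => //; first by clear -d'u dE; lia.
  apply: (hclosed_iter_eq (n := f) (p := u) (q := del)) => //.
  by clear -d'u dE; subst; lia.
have Se1 : fiber E F d' e1.
  apply/and3P; split => //; first by clear -d'w d1E; lia.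
  apply: (hclosed_iter_eq (n := f1) (p := w) (q := 0)) => //.
  by clear -d'w d1E; subst; lia.
split => //.
- by rewrite Se; apply/arcP; exists 0, 0; split => //; clear; lia.
- by rewrite Se1.
apply: arc_separates d'u _ => //.
by case: uw => [|->]; [left|right].
Qed.

End OnePair.

Definition gap (E' : pred nat) e := xget 0 (gap_spec E' e : set nat).

Lemma gap_specP E' e : hclosed E' -> nonprincipal E' -> gen E' e ->
  gap_spec E' e (gap E' e).
Proof.
by move=> E'H npE' eG; apply: (@xgetPex _ 0 (gap_spec E' e : set nat)); exact: gapP.
Qed.

(** The largest shift that moves e within its arc and f within its own. *)
Definition width (p : nat * nat) := (minn (gap E p.1) (gap F p.2)).-1.
Definition degree (p : nat * nat) := p.1 + p.2 + width p * b.
Definition genpair (p : nat * nat) := gen E p.1 && gen F p.2.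

Lemma width_lt p : genpair p -> width p < gap E p.1 /\ width p < gap F p.2.
Proof.
move=> /andP[/(gap_specP EH npE)[G0 _ _ _] /(gap_specP FH npF)[D0 _ _ _]].
by rewrite /width; clear -G0 D0; lia.
Qed.

Lemma pair_strip_separates p : genpair p ->
  separates E F (degree p) (strip p.1 (width p)).
Proof.
move=> pG; have [lE lF] := width_lt pG; have /andP[eG fG] := pG.
exact: (strip_separates eG fG (gap_specP EH npE eG) (gap_specP FH npF fG)).
Qed.

Lemma pair_strip_fiber p x : genpair p -> strip p.1 (width p) x ->
  fiber E F (degree p) x.
Proof. by move=> /pair_strip_separates[+ _ _]; apply. Qed.

(** A strip contains one generator of E, its lowest point, and the complements
    of its points contain one generator of F. *)
Lemma strip_disjoint p q x : genpair p -> genpair q -> degree p = degree q ->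
  strip p.1 (width p) x -> strip q.1 (width q) x -> p = q.
Proof.
move=> /andP[pE pF] /andP[qE qF] pq /stripP[k kp xk] /stripP[l lq xl].
have [Ep Fp] : E p.1 /\ F p.2 by case/and3P: pE; case/and3P: pF.
have [Eq Fq] : E q.1 /\ F q.2 by case/and3P: qE; case/and3P: qF.
rewrite /degree in pq; case: p q => [e f] [e' f'] /= in pE pF qE qF xk xl kp lq pq Ep Fp Eq Fq *.
move: (width (e, f)) (width (e', f')) kp lq pq => w w' kp lq pq.
have dk : (w - k) * b + k * b = w * b by rewrite -mulnDl subnK.
have dl : (w' - l) * b + l * b = w' * b by rewrite -mulnDl subnK.
have -> : e = e'.
  have [kl|lk] := leqP k l.
    have kl' : (l - k) * b + k * b = l * b by rewrite -mulnDl subnK.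
    have [|_ l0] := gen_minimal (p := 0) (q := l - k) EH pE Eq.
      by clear -kl' xk xl; lia.
    by rewrite l0 in kl'; clear -kl' xk xl; lia.
  have kl' : (k - l) * b + l * b = k * b by rewrite -mulnDl subnK // ltnW.
  have [|_ l0] := gen_minimal (p := 0) (q := k - l) EH qE Ep.
    by clear -kl' xk xl; lia.
  by rewrite l0 in kl'; clear -kl' xk xl; lia.
congr pair.
have [kl|lk] := leqP (w - k) (w' - l).
  have kl' : (w' - l - (w - k)) * b + (w - k) * b = (w' - l) * b by rewrite -mulnDl subnK.
  have [|_ l0] := gen_minimal (p := 0) (q := w' - l - (w - k)) FH pF Fq.
    by clear -kl' xk xl dk dl pq; lia.
  by rewrite l0 in kl'; clear -kl' xk xl pq dk dl; lia.
have kl' : (w - k - (w' - l)) * b + (w' - l) * b = (w - k) * b by rewrite -mulnDl subnK // ltnW.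
have [|_ l0] := gen_minimal (p := 0) (q := w - k - (w' - l)) FH qF Fp.
  by clear -kl' xk xl dk dl pq; lia.
by rewrite l0 in kl'; clear -kl' xk xl pq dk dl; lia.
Qed.

(** Lowering the degree by a removes every point of the strip of p from the
    fiber, whereas q.1 stays down to the degree of q; in equal degrees the two
    strips are disjoint. *)
Lemma base_fiber p q : genpair p -> genpair q -> degree q <= degree p ->
    degree q = degree p %[mod a] -> p != q ->
  fiber E F (degree p) q.1 /\ ~~ strip p.1 (width p) q.1.
Proof.
move=> pG qG le /esym/eqP; rewrite eqn_mod_dvd // => /dvdnP[u uE] pq.
have /andP[qE qF] := qG; have /andP[pE pF] := pG.
have Fq : F q.2 by case/and3P: qF.
have Fqd : F (degree p - q.1).
  apply: (hclosed_iter_eq (n := q.2) (p := u) (q := width q)) => //.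
  by rewrite /degree in uE le *; clear -uE le; lia.
split.
  apply/and3P; split => //; first by case/and3P: qE.
  by apply: leq_trans le; rewrite /degree; clear; lia.
apply/negP => pq1; case: u uE => [|u] uE.
  case/eqP: pq; apply: (@strip_disjoint _ _ q.1) => //.
    by clear -uE le; lia.
  by apply/stripP; exists 0; rewrite ?addn0.
have [_ lF] := width_lt pG.
case/stripP: pq1 => k kp qk.
have dk : (width p - k) * b + k * b = width p * b by rewrite -mulnDl subnK.
have Fu : F (q.2 + u * a + width q * b) by exact: hclosed_iter.
have := gap_minimal (k := width p - k) (p := 1) (q := 0) FH pF (gap_specP FH npF pF) _ Fu.
rewrite (leq_ltn_trans (leq_subr _ _) lF) => /(_ isT).
rewrite /degree in uE le *.
by clear -uE le dk qk; lia.
Qed.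

Section Count.
Variables gE gF : seq nat.
Hypotheses (gEu : uniq gE) (gFu : uniq gF).
Hypotheses (gEP : all (gen E) gE) (gFP : all (gen F) gF).

Let P := [seq (e, f) | e <- gE, f <- gF].

Lemma pair_genpair p : p \in P -> genpair p.
Proof.
move=> /allpairsP[[e f] /= [eE fF ->]].
by apply/andP; split; [exact: (allP gEP)|exact: (allP gFP)].
Qed.

Definition same_class (p q : nat * nat) := degree p == degree q %[mod a].

Definition is_base s (q : nat * nat) := [/\ q \in P, degree q = s %[mod a] &
  forall r, r \in P -> degree r = s %[mod a] -> degree q <= degree r].

Definition base p := xget (0, 0) (is_base (degree p %% a) : set (nat * nat)).

Lemma baseP p : p \in P -> is_base (degree p %% a) (base p).
Proof.
move=> pP; apply: (@xgetPex _ (0, 0) (is_base (degree p %% a) : set (nat * nat))).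
have ex : exists d, `[< exists q, [/\ q \in P, degree q = degree p %[mod a] & d = degree q] >].
  by exists (degree p); apply/asboolP; exists p.
case: (ex_minnP ex) => d /asboolP[q [qP qp dE]] dmin.
exists q; split => //; first by rewrite modn_mod.
move=> r rP; rewrite modn_mod => rp.
by rewrite -dE; apply: dmin; apply/asboolP; exists r.
Qed.

Lemma base_eq p q : same_class p q -> base p = base q.
Proof. by rewrite /same_class /base => /eqP ->. Qed.

Definition others p := [seq q <- P | (q != p) && same_class q p].
Definition keep p := (p != base p) || (others p == [::]).

(** At most one pair per class is dropped, and only when the class has another
    pair, which is kept; this sends dropped pairs injectively to kept ones. *)
Lemma size_keep : size gE * size gF <= (size [seq p <- P | keep p]).*2.
Proof.
rewrite -(size_allpairs pair gE gF) -/P -(count_predC keep P) -!size_filter.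
rewrite -addnn leq_add2l.
pose g p := head p (others p).
have uP : uniq P by apply: allpairs_uniq => // -[? ?] [? ?].
have gP p : p \in P -> ~~ keep p -> [/\ p = base p, g p \in P, g p != p & same_class (g p) p].
  move=> pP; rewrite negb_or negbK => /andP[/eqP pb no].
  have : g p \in others p.
    by rewrite /g; case: (others p) no => //= q s _; rewrite mem_head.
  by rewrite mem_filter => /andP[/andP[? ?] ?].
rewrite -[leqLHS](size_map g); apply: uniq_leq_size.
  rewrite map_inj_in_uniq ?filter_uniq // => p q.
  rewrite !mem_filter => /andP[/= kp pP] /andP[/= kq qP] gpq.
  have [pb _ _ gp] := gP _ pP kp; have [qb _ _ gq] := gP _ qP kq.
  by rewrite pb qb -(base_eq gp) gpq (base_eq gq).
move=> x /mapP[p]; rewrite mem_filter => /andP[/= kp pP] ->.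
have [pb gpP gpp gp] := gP _ pP kp.
by rewrite mem_filter gpP andbT /keep (base_eq gp) -pb gpp.
Qed.

Record splitting := Splitting {
  sdeg : nat; sfst : nat; ssnd : nat; spart : pred nat }.

Definition splitting_valid (t : splitting) :=
  splits E F (sdeg t) (sfst t) (ssnd t) (spart t).

Definition pair_splitting p := Splitting (degree p) p.1 (base p).1 (strip p.1 (width p)).
End Count.
End Family.

(** The arc of the generator with the larger gap is used, after exchanging E and
    F if necessary. *)
Lemma lone_splitting E F (EH : hclosed E) (FH : hclosed F)
    (npE : nonprincipal E) (npF : nonprincipal F) p : genpair E F p ->
  exists d e1 e2 C, splits E F d e1 e2 C /\ d = degree E F p %[mod a].
Proof.
move=> pG; have [lE lF] := width_lt EH FH npE npF pG; have /andP[eG fG] := pG.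
have sE := gap_specP EH npE eG; have sF := gap_specP FH npF fG.
have [EG0 _ _ _] := sE; have [FG0 _ _ _] := sF.
have [le|lt] := leqP (gap F p.2) (gap E p.1).
  have [||d [e2 [C [? ?]]]] := arc_splits EH FH eG fG sE sF lE lF (erefl (degree E F p)).
  - by rewrite /width (minn_idPr le) prednK.
  - by [].
  by exists d, p.1, e2, C.
have degE : degree E F p = p.2 + p.1 + width E F p * b by rewrite addnC [p.2 + _]addnC addnC.
have [||d [e2 [C [sC dd]]]] := arc_splits FH EH fG eG sF sE lF lE degE.
- by rewrite /width (minn_idPl (ltnW lt)) prednK.
- exact: ltnW.
exists d, (d - p.2), (d - e2), (fun x => (x <= d) && C (d - x)); split => //.
exact: splits_swap.
Qed.

(** In one degree, two members of the family come from the same class, so that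
    both are given by strips; each strip avoids the other strip and the common
    base point.  This is what makes the torsion elements of one degree
    independent. *)
Theorem splitting_family E F (EH : hclosed E) (FH : hclosed F)
    (npE : nonprincipal E) (npF : nonprincipal F) (gE gF : seq nat) :
    uniq gE -> uniq gF -> all (gen E) gE -> all (gen F) gF ->
  exists (L : seq (nat * nat)) (s : nat * nat -> splitting),
    [/\ uniq L, size gE * size gF <= (size L).*2,
      forall p, p \in L -> splitting_valid E F (s p) &
      forall p q, p \in L -> q \in L -> p != q -> sdeg (s p) = sdeg (s q) ->
        ~~ spart (s p) (sfst (s q)) && ~~ spart (s p) (ssnd (s q))].
Proof.
move=> gEu gFu gEP gFP.
pose P := [seq (e, f) | e <- gE, f <- gF].
pose L := [seq p <- P | keep E F gE gF p].
have uP : uniq P by apply: allpairs_uniq => // -[? ?] [? ?].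
have Pg p : p \in P -> genpair E F p by exact: pair_genpair.
have : forall p, exists t : splitting, p \in L ->
    [/\ splitting_valid E F t, sdeg t = degree E F p %[mod a] &
        others E F gE gF p <> [::] -> t = pair_splitting E F gE gF p].
  move=> p; have [pL|pL] := boolP (p \in L); last by exists (Splitting 0 0 0 pred0).
  move: pL; rewrite mem_filter => /andP[kp pP]; have pG := Pg _ pP.
  have [o0|oN] := eqVneq (others E F gE gF p) [::].
    have [d [e1 [e2 [C [sC dE]]]]] := lone_splitting EH FH npE npF pG.
    by exists (Splitting d e1 e2 C) => _; split.
  exists (pair_splitting E F gE gF p) => _; split => //.
  have [bP bE bmin] := baseP E F pP.
  rewrite modn_mod in bE.
  have le : degree E F (base E F gE gF p) <= degree E F p.
    by apply: bmin => //; rewrite modn_mod.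
  have pb : p != base E F gE gF p by move: kp; rewrite /keep (negPf oN) orbF.
  have [bf bN] := base_fiber EH FH npE npF pG (Pg _ bP) le bE pb.
  have s0 : strip p.1 (width E F p) p.1 by apply/stripP; exists 0; rewrite ?addn0.
  split => //; last exact: pair_strip_separates.
  exact: pair_strip_fiber.
move=> /choice[s sP]; exists L, s; split.
- exact: filter_uniq.
- exact: size_keep.
- by move=> p /sP[].
move=> p q pL qL pq sdE.
have [_ sp spE] := sP _ pL; have [_ sq sqE] := sP _ qL.
have cl : degree E F p = degree E F q %[mod a] by rewrite -sp sdE sq.
have [pP kp] : p \in P /\ keep E F gE gF p by move: pL; rewrite mem_filter => /andP[].
have [qP kq] : q \in P /\ keep E F gE gF q by move: qL; rewrite mem_filter => /andP[].
have po : q \in others E F gE gF p.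
  by rewrite mem_filter qP eq_sym pq /= andbT; apply/eqP/esym.
have qo : p \in others E F gE gF q by rewrite mem_filter pP pq /= andbT; apply/eqP.
have pN : others E F gE gF p <> [::] by move=> H; rewrite H in po.
have qN : others E F gE gF q <> [::] by move=> H; rewrite H in qo.
rewrite spE // sqE //= in sdE *.
rewrite -(@base_eq E F gE gF p q); last exact/eqP.
apply/andP; split.
  apply/negP => qs; case/eqP: pq; apply: (strip_disjoint EH FH _ _ sdE qs).
  - exact: Pg.
  - exact: Pg.
  by apply/stripP; exists 0; rewrite ?addn0.
have [bP bE bmin] := baseP E F pP.
rewrite modn_mod in bE.
have le : degree E F (base E F gE gF p) <= degree E F p.
  by apply: bmin => //; rewrite modn_mod.
have pb : p != base E F gE gF p.
  by move: kp; rewrite /keep; case/orP => // /eqP.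
by have [] := base_fiber EH FH npE npF (Pg _ pP) (Pg _ bP) le bE pb.
Qed.

End Staircases.

(** * Length, number of generators, and tensor products *)

(** The order on the extended rationals is not complete, but a set of naturals is
    either finite or has +oo as its only upper bound. *)
Lemma nat_supremums_bar (A : set nat) :
  (supremums [set (n%:R : rat)%:E | n in A]%classic !=set0)%classic.
Proof.
have [[B AB]|unb] := pselect (exists B, forall n, A n -> (n <= B)%N).
  have [[n0 An0]|A0] := pselect (exists n, A n); last first.
    exists -oo%E; split; last by move=> y _; exact: leNye.
    by move=> y [n An _]; case: A0; exists n.
  have exA : exists n, `[< A n >] by exists n0; apply/asboolP.
  have Ab n : `[< A n >] -> (n <= B)%N by move=> /asboolP/AB.
  case: (ex_maxnP exA Ab) => m /asboolP Am mmax.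
  exists (m%:R : rat)%:E; split; last by move=> y; apply; exists m.
  by move=> _ [n An <-]; rewrite lee_fin ler_nat mmax //; apply/asboolP.
exists +oo%E; split; first by move=> y _; exact: leey.
move=> [r| |] // ubr.
  exfalso; apply: unb; exists (Num.bound `|r|) => n An.
  have := ubr _ (ex_intro2 _ _ n An erefl); rewrite lee_fin => nr.
  have rb : r < (Num.bound `|r|)%:R.
    exact: le_lt_trans (ler_norm r) (archi_boundP (normr_ge0 r)).
  by have := le_lt_trans nr rb; rewrite ltr_nat => /ltnW.
exfalso; apply: unb; exists 0%N => n An.
by have := ubr _ (ex_intro2 _ _ n An erefl).
Qed.

Lemma nat_sup_ge (A : set nat) n : A n -> ((n%:R : rat)%:E <= nat_sup A)%E.
Proof.
move=> An; apply: ge_supremum_Nmem; first exact: nat_supremums_bar.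
by exists n.
Qed.

Lemma nat_inf_bounds (A : set nat) n : A n ->
  ((0 : rat)%:E <= nat_inf A)%E /\ (nat_inf A <= (n%:R : rat)%:E)%E.
Proof.
move=> An.
have exA : exists n, `[< A n >] by exists n; apply/asboolP.
case: (ex_minnP exA) => m /asboolP Am mmin.
have lbm : lbound [set (n%:R : rat)%:E | n in A]%classic (m%:R : rat)%:E.
  by move=> _ [k Ak <-]; rewrite lee_fin ler_nat mmin //; apply/asboolP.
have inf_ne : (infimums [set (n%:R : rat)%:E | n in A]%classic !=set0)%classic.
  exists (m%:R : rat)%:E; split => //.
  by move=> y; apply; exists m.
split; last by apply: le_infimum_Nmem => //; exists n.
rewrite /nat_inf /infimum; case: ifPn => [/eqP A0|_].
  by have : [set (n%:R : rat)%:E | n in A]%classic (n%:R)%:E; [exists n|rewrite A0].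
case: xgetP => [y _ [_ ly]|_]; last exact: leey.
by apply: le_trans (ly _ lbm); rewrite lee_fin ler0n.
Qed.

Section Span.
Variables (R : comNzRingType) (M : lmodType R).

Lemma submod_span_ind (P : M -> Prop) (G : set M) :
  P 0 -> (forall c x y, P x -> P y -> P (c *: x + y)) ->
  (forall g, G g -> P g) -> forall x, x \in submod_span G -> P x.
Proof.
move=> P0 PL PG x /asboolP xG.
pose S : {pred M} := fun x => `[< P x >].
have SP : GRing.submod_closed S.
  split; first exact/asboolP.
  by move=> c y z /asboolP Py /asboolP Pz; apply/asboolP; exact: PL.
pose N : submodClosed M := HB.pack S (GRing.isSubmodClosed.Build R M S SP).
by apply/asboolP/(xG N) => g /PG Pg; apply/asboolP.
Qed.

Lemma submod_span_gen (G : set M) g : G g -> g \in submod_span G.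
Proof. by move=> Gg; apply/asboolP => N; exact. Qed.

Lemma submod_spanL (G : set M) c x y : x \in submod_span G ->
  y \in submod_span G -> c *: x + y \in submod_span G.
Proof. by move=> xG yG; rewrite rpredD ?rpredZ. Qed.

Lemma submod_span_le (G G' : set M) x :
  (forall g, G g -> g \in submod_span G') -> x \in submod_span G ->
  x \in submod_span G'.
Proof.
move=> GG'; apply: (submod_span_ind (P := fun x => x \in submod_span G')) => //.
  exact: rpred0.
by move=> c y z; exact: submod_spanL.
Qed.

End Span.

Section TensorTheory.
Variables (R : comNzRingType) (M N : lmodType R).

Definition pure_tensor (x : M) (y : N) : tensor M N :=
  \pi_(quotient_module (submod_span (@tensor_relations R M N)))%qT
    (Freeg [:: (1, (x, y))]).

Lemma pure_tensorZl c x y : pure_tensor (c *: x) y = c *: pure_tensor x y.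
Proof.
rewrite /pure_tensor [RHS](@quotient_piZ R _ (submod_span (@tensor_relations R M N))).
apply/quotient_eqP/submod_span_gen.
by apply: Or43; exists c, x, y.
Qed.

Lemma pure_tensorZr c x y : pure_tensor x (c *: y) = c *: pure_tensor x y.
Proof.
rewrite /pure_tensor [RHS](@quotient_piZ R _ (submod_span (@tensor_relations R M N))).
apply/quotient_eqP/submod_span_gen.
by apply: Or44; exists c, x, y.
Qed.

(** The universal property, with linearity spelled out: the bilinear map extends
    to the free module on pairs and kills the defining relations. *)
Lemma tensor_lift (Q : lmodType R) (f : M -> N -> Q) :
  (forall c x x' y, f (c *: x + x') y = c *: f x y + f x' y) ->
  (forall c x y y', f x (c *: y + y') = c *: f x y + f x y') ->
  exists g : tensor M N -> Q,
    [/\ forall c z z', g (c *: z + z') = c *: g z + g z' &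
        forall x y, g (pure_tensor x y) = f x y].
Proof.
move=> fl fr.
have f0l y : f 0 y = 0.
  by have := fl (-1) 0 0 y; rewrite scaler0 addr0 scaleN1r addNr.
have f0r x : f x 0 = 0.
  by have := fr (-1) x 0 0; rewrite scaler0 addr0 scaleN1r addNr.
pose F : {freeg (M * N)%type / R} -> Q := fglift (fun p : (M * N)%type => f p.1 p.2).
have FB x y : F (x - y) = F x - F y by exact: lift_is_additive.
have F0 : F 0 = 0 by rewrite -(subrr (0 : {freeg (M * N)%type / R})) FB subrr.
have FN x : F (- x) = - F x by rewrite -[- x]sub0r FB F0 sub0r.
have FD x y : F (x + y) = F x + F y by rewrite -{1}[y]opprK FB FN opprK.
have FU c p : F (Freeg [:: (c, p)]) = c *: f p.1 p.2 by exact: liftU.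
have FZ c x : F (c *: x) = c *: F x.
  rewrite -{2}[x]freeg_sumE [c *: x]/(fgscale c x) /fgscale.
  rewrite !(big_morph F FD F0) scaler_sumr; apply: eq_bigr => p _.
  by rewrite !FU scalerA.
have Frel z : z \in submod_span (@tensor_relations R M N) -> F z = 0.
  apply: (submod_span_ind (P := fun z => F z = 0)) => // [c x y Fx Fy|_ [[x [x' [y ->]]]|[x [y [y' ->]]]|[c [x [y ->]]]|[c [x [y ->]]]]].
  - by rewrite FD FZ Fx Fy scaler0 addr0.
  - by have := fl 1 x x' y; rewrite FB FD !FU /= !scale1r => ->; rewrite subrr.
  - by have := fr 1 x y y'; rewrite FB FD !FU /= !scale1r => ->; rewrite subrr.
  - by have := fl c x 0 y; rewrite FB FZ !FU /= !scale1r f0l !addr0 => ->; rewrite subrr.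
  by have := fr c x y 0; rewrite FB FZ !FU /= !scale1r f0r !addr0 => ->; rewrite subrr.
have Fpi (z : {freeg (M * N)%type / R}) :
    F (repr (\pi_(quotient_module (submod_span (@tensor_relations R M N))) z)%qT) = F z.
  apply/eqP; rewrite -subr_eq0 -FB; apply/eqP/Frel/quotient_eqP.
  by rewrite reprK.
exists (fun z => F (repr z)); split=> [c z z'|x y]; last by rewrite Fpi FU scale1r.
rewrite -FZ -FD -[LHS]/(F (repr (c *: z + z')))%qT.
rewrite -[z in LHS]reprK -[z' in LHS]reprK.
rewrite [c *: _](@quotient_piZ R _ (submod_span (@tensor_relations R M N))).
by rewrite -(@quotient_piD R _ (submod_span (@tensor_relations R M N))) Fpi.
Qed.
End TensorTheory.

Section Length.
Variables (R : comNzRingType) (M : lmodType R).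

(** The spans of tau 0, ..., tau (i - 1) strictly increase, because the submodule
    P separates the next element from the previous ones. *)
Lemma module_length_ge (tau : nat -> M) n :
  (forall i, (i < n)%N -> exists P : M -> Prop,
     [/\ P 0, forall c x y, P x -> P y -> P (c *: x + y),
         forall j, (j < i)%N -> P (tau j) & ~ P (tau i)]) ->
  ((n%:R : rat)%:E <= module_length M)%E.
Proof.
move=> sep; apply: nat_sup_ge.
pose G i : set M := [set tau j | j in [set j | (j < i)%N]]%classic.
exists (fun i => submod_span (G i) : submodClosed M) => i lt_in; split.
  move=> x; apply: submod_span_le => _ [j /= lt_ji <-].
  by apply: submod_span_gen; exists j => //=; apply: ltnW.
move=> /(_ (tau i)) H; have [P [P0 PL Pj NPi]] := sep i lt_in.
apply: NPi; apply: (submod_span_ind (P := P) (G := G i)) => //.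
  by move=> _ [j /= lt_ji <-]; exact: Pj.
by apply: H; apply: submod_span_gen; exists i => //=.
Qed.

Lemma mu_bounds (s : seq M) :
  (forall x, x \in submod_span [set` s]%classic) ->
  ((0 : rat)%:E <= mu M)%E /\ (mu M <= ((size s)%:R : rat)%:E)%E.
Proof. by move=> sM; apply: nat_inf_bounds; exists s. Qed.

End Length.

Section Torsion.
Variables (R : idomainType) (I J : submodClosed R^o).

(** Multiplying by xy = x'y' and moving scalars across the tensor sign turns both
    tensors into xx' ⊗ yy'. *)
Lemma torsion_pure_tensorB (x x' : submodule I) (y y' : submodule J) :
  (val x : R) * val y = val x' * val y' -> (val x : R) * val y != 0 ->
  pure_tensor x y - pure_tensor x' y' \in torsion (tensor (submodule I) (submodule J)).
Proof.
move=> xy xy0; apply/asboolP; exists ((val x : R) * val y) => //.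
have ZZ (c d : R) (u : submodule I) (v : submodule J) :
    (c * d) *: pure_tensor u v = pure_tensor (c *: u) (d *: v).
  by rewrite pure_tensorZl pure_tensorZr scalerA.
rewrite scalerBr {1}xy !ZZ.
have -> : (val x' : R) *: x = (val x : R) *: x'.
  by apply: val_inj; rewrite !linearZ; exact: mulrC.
have -> : (val y' : R) *: y = (val y : R) *: y'.
  by apply: val_inj; rewrite !linearZ; exact: mulrC.
exact: subrr.
Qed.
End Torsion.

(** * Spans of monomials and linear maps that split fibers *)

Section MonomialSpan.
Variables (R : idomainType) (a b : nat) (mon : nat -> R).

Definition mspan (X : pred nat) : submodClosed R^o :=
  submod_span [set (mon n : R^o) | n in [set n | X n]]%classic.

Definition exponents (X : pred nat) :=
  hclosed a b X /\ forall n, X n -> sgp a b n.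

(** What the argument needs from the ring.  For a graded ring these are
    statements about supports; in general they say that monomials have no
    unexpected linear relations. *)
Record monomials : Prop := Monomials {
  monD : forall m n, sgp a b m -> sgp a b n -> mon (m + n) = mon m * mon n;
  mspan_cap : forall X Y x, exponents X -> exponents Y ->
    x \in mspan X -> x \in mspan Y -> x \in mspan (predI X Y);
  mspan_exp : forall X n, exponents X -> sgp a b n -> mon n \in mspan X -> X n }.

Lemma mspan_mon (X : pred nat) n : X n -> mon n \in mspan X.
Proof. by move=> Xn; apply: submod_span_gen; exists n. Qed.

Lemma mspanL (X : pred nat) (c x y : R) :
  x \in mspan X -> y \in mspan X -> c * x + y \in mspan X.
Proof. exact: (@submod_spanL R R^o). Qed.

Lemma mspanB (X : pred nat) (x y : R) :
  x \in mspan X -> y \in mspan X -> x - y \in mspan X.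
Proof. by move=> xX yX; rewrite addrC -mulN1r; exact: mspanL. Qed.

Lemma mspan0 (X : pred nat) : (0 : R) \in mspan X.
Proof. exact: rpred0. Qed.

Lemma mspanZ (X : pred nat) (c x : R) : x \in mspan X -> c * x \in mspan X.
Proof. by move=> xX; rewrite -[_ * _]addr0 mspanL ?mspan0. Qed.

Lemma mspanD (X : pred nat) (x y : R) :
  x \in mspan X -> y \in mspan X -> x + y \in mspan X.
Proof. by move=> xX yX; rewrite -[x]mul1r; exact: mspanL. Qed.

Lemma mspan_ind (X : pred nat) (P : R -> Prop) :
  P 0 -> (forall c x y, P x -> P y -> P (c * x + y)) ->
  (forall n, X n -> P (mon n)) -> forall x, x \in mspan X -> P x.
Proof.
move=> P0 PL PX; apply: (@submod_span_ind R R^o P) => //.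
by move=> _ [n /= Xn <-]; exact: PX.
Qed.

Lemma mspan_sub (X Y : pred nat) x : subpred X Y -> x \in mspan X -> x \in mspan Y.
Proof.
move=> XY; apply: (mspan_ind (P := fun x => x \in mspan Y)) => //.
- exact: mspan0.
- by move=> *; exact: mspanL.
by move=> n /XY; exact: mspan_mon.
Qed.

Hypothesis mono : monomials.

Lemma mspanM (X Y Z : pred nat) x y : exponents X -> exponents Y ->
  (forall m n, X m -> Y n -> Z (m + n)%N) ->
  x \in mspan X -> y \in mspan Y -> x * y \in mspan Z.
Proof.
move=> [_ XH] [_ YH] XYZ xX yY.
apply: (mspan_ind (P := fun x => x * y \in mspan Z)) xX => [|c u v uP vP|m Xm].
- by rewrite mul0r mspan0.
- by rewrite mulrDl -mulrA mspanL.
rewrite mulrC.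
apply: (mspan_ind (P := fun y => y * mon m \in mspan Z)) yY => [|c u v uP vP|n Yn].
- by rewrite mul0r mspan0.
- by rewrite mulrDl -mulrA mspanL.
rewrite mulrC -(monD mono); [|exact: XH|exact: YH].
by apply: mspan_mon; exact: XYZ.
Qed.

Lemma exponents0 : exponents pred0. Proof. by []. Qed.

Lemma mon_neq0 n : sgp a b n -> mon n != 0.
Proof.
move=> Hn; apply/eqP => n0.
have := mspan_exp mono (n := n) exponents0 Hn.
by rewrite n0 mspan0 => /(_ isT).
Qed.

Lemma sgpD m n : sgp a b m -> sgp a b n -> sgp a b (m + n).
Proof.
move=> /sgpP[p [q ->]] /sgpP[p' [q' ->]]; apply/sgpP.
by exists (p + p')%N, (q + q')%N; lia.
Qed.

Lemma sgp_a : sgp a b a. Proof. by apply/sgpP; exists 1%N, 0%N; lia. Qed.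
Lemma sgp_b : sgp a b b. Proof. by apply/sgpP; exists 0%N, 1%N; lia. Qed.

Section Functional.
Variables (I J : submodClosed R^o) (E F : pred nat).
Hypotheses (expE : exponents E) (expF : exponents F).
Hypotheses (IE : I =i mspan E) (JF : J =i mspan F).

Section Degree.
Variables (d : nat) (C : pred nat).
Hypothesis sepC : separates a b E F d C.

(** The exponents n in H with d - n outside H.  All n > d in H are among them but
    d is not, so that modulo their span the monomial of exponent d is the last
    one to survive. *)
Definition below : pred nat := fun n => sgp a b n && ~~ ((n <= d)%N && sgp a b (d - n)).

Lemma exponents_below : exponents below.
Proof.
have step h n : sgp a b h -> below n -> below (n + h)%N.
  move=> Hh /andP[Hn Nn]; rewrite /below sgpD //=.
  apply: contra Nn => /andP[le Hd]; apply/andP; split; first by lia.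
  by have -> : (d - n = d - (n + h) + h)%N; [lia|exact: sgpD].
split=> [n Bn|n /andP[]//]; split; apply: step => //; [exact: sgp_a|exact: sgp_b].
Qed.

(** Exponents outside the fiber belong to both [inner] and [outer]: this is what
    makes the two sets closed under H, and products of such exponents with F
    fall into [below]. *)
Definition inner : pred nat := fun e => E e && (C e || ~~ fiber E F d e).
Definition outer : pred nat := fun e => E e && ~~ C e.

Lemma fiber_down e h : sgp a b h -> E e -> fiber E F d (e + h) -> fiber E F d e.
Proof.
move=> Hh Ee /and3P[_ le Fd]; apply/and3P; split => //; first by lia.
have -> : (d - e = d - (e + h) + h)%N by lia.
by have [FH _] := expF; exact: (hclosed_sgp FH).
Qed.

Lemma exponents_inner : exponents inner.
Proof.
have [EH EHs] := expE; have [CS Ca Cb] := sepC.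
split=> [n /andP[En Cn]|n /andP[/EHs]//]; have [Ea Eb] := EH _ En.
split; rewrite /inner ?Ea ?Eb /=.
  have [Sa|] := boolP (fiber E F d (n + a)); last by rewrite orbT.
  have Sn := fiber_down sgp_a En Sa.
  by move: Cn; rewrite Sn orbF orbF -Ca.
have [Sb|] := boolP (fiber E F d (n + b)); last by rewrite orbT.
have Sn := fiber_down sgp_b En Sb.
by move: Cn; rewrite Sn orbF orbF -Cb.
Qed.

Lemma exponents_outer : exponents outer.
Proof.
have [EH EHs] := expE; have [CS Ca Cb] := sepC.
split=> [n /andP[En Cn]|n /andP[/EHs]//]; have [Ea Eb] := EH _ En.
split; rewrite /outer ?Ea ?Eb /=; apply: contra Cn => Ch; have Sh := CS _ Ch.
  by rewrite Ca // (fiber_down sgp_a En).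
by rewrite Cb // (fiber_down sgp_b En).
Qed.

Lemma mspan_decomp x : x \in mspan E ->
  exists x1, x1 \in mspan inner /\ x - x1 \in mspan outer.
Proof.
apply: (mspan_ind (P := fun x => exists x1, x1 \in mspan inner /\ x - x1 \in mspan outer)).
- by exists 0; rewrite subr0 !mspan0.
- move=> c u v [u1 [u1P uP]] [v1 [v1P vP]]; exists (c * u1 + v1); split.
    exact: mspanL.
  by rewrite opprD addrACA -mulrBr mspanL.
move=> n En; have [Cn|Cn] := boolP (C n).
  by exists (mon n); rewrite subrr mspan0 mspan_mon // /inner En Cn.
by exists 0; rewrite subr0 mspan0 mspan_mon // /outer En Cn.
Qed.

(** Two choices of the inner part differ by an element of both spans, hence by
    exponents m outside the fiber.  For n in F, if d - (m + n) were in H, then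
    d - m would be in F. *)
Lemma mspan_decomp_uniq x1 x2 z y :
  x1 \in mspan inner -> z - x1 \in mspan outer ->
  x2 \in mspan inner -> z - x2 \in mspan outer -> y \in mspan F ->
  (x1 - x2) * y \in mspan below.
Proof.
move=> x1i x1o x2i x2o yF.
have [EH EHs] := expE; have [FH FHs] := expF; have [CS _ _] := sepC.
have capP : x1 - x2 \in mspan (predI inner outer).
  apply: (mspan_cap mono exponents_inner exponents_outer); first exact: mspanB.
  have -> : x1 - x2 = (z - x2) - (z - x1).
    by rewrite opprB [RHS]addrC addrA subrK.
  exact: mspanB.
apply: mspanM capP yF => //.
  have [iH iHs] := exponents_inner; have [oH _] := exponents_outer.
  split=> [n /andP[/= /iH[ia ib] /oH[oa ob]]|n /andP[/= /iHs]//].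
  by split; apply/andP.
move=> m n /andP[/= /andP[Em im] /andP[_ om]] Fn.
have Nm : ~~ fiber E F d m by move: im; rewrite (negPf om).
have Hmn : sgp a b (m + n) by apply: sgpD; [exact: EHs|exact: FHs].
rewrite /below Hmn /=; apply: contra Nm => /andP[le Hd].
apply/and3P; split => //; first by lia.
have -> : (d - m = n + (d - (m + n)))%N by lia.
exact: (hclosed_sgp FH).
Qed.

(** The map sends x ⊗ y to x1 * y modulo the span of [below], where x1 is an inner
    part of x.  Degree d survives exactly on C, and larger degrees vanish because
    [below] contains every n > d. *)
Lemma fiber_functional : exists Q : lmodType R,
  exists g : tensor (submodule I) (submodule J) -> Q,
  [/\ forall c z z', g (c *: z + z') = c *: g z + g z',
      forall (x : submodule I) (y : submodule J) e f, E e -> F f ->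
        val x = mon e -> val y = mon f -> (d < e + f)%N -> g (pure_tensor x y) = 0 &
      forall (x : submodule I) (y : submodule J) e f, E e -> F f ->
        val x = mon e -> val y = mon f -> (e + f)%N = d ->
        if C e then g (pure_tensor x y) <> 0 else g (pure_tensor x y) = 0].
Proof.
have [EH EHs] := expE; have [FH FHs] := expF; have [CS _ _] := sepC.
have : forall x : submodule I, exists x1 : R,
    x1 \in mspan inner /\ (val x : R) - x1 \in mspan outer.
  by move=> x; apply: mspan_decomp; rewrite -IE; exact: valP.
move=> /choice[p pP].
have yF (y : submodule J) : (val y : R) \in mspan F by rewrite -JF; exact: valP.
pose Q : lmodType R := quotient_module (mspan below).
pose pi (z : R^o) : Q := \pi_(quotient_module (mspan below))%qT z.
have piE (x y : R) : pi x = pi y <-> x - y \in mspan below by exact: quotient_eqP.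
have piL (c x y : R) : pi (c * x + y) = c *: pi x + pi y.
  by rewrite /pi (@quotient_piD R R^o) -(@quotient_piZ R R^o).
pose f (x : submodule I) (y : submodule J) := pi (p x * val y).
have fE (x : submodule I) (y : submodule J) (x1 : R) : x1 \in mspan inner ->
    (val x : R) - x1 \in mspan outer -> f x y = pi (x1 * val y).
  move=> x1i x1o; apply/piE; rewrite -mulrBl.
  by have [pi' po] := pP x; exact: (mspan_decomp_uniq pi' po x1i x1o).
have [||g [gL gp]] := @tensor_lift R (submodule I) (submodule J) Q f.
- move=> c x x' y; have [pi1 po1] := pP x; have [pi2 po2] := pP x'.
  rewrite (fE _ _ (c * p x + p x')); last 2 first.
  + exact: mspanL.
  + rewrite [val (c *: x + x')](_ : _ = (c * val x + val x' : R)); last first.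
      by rewrite linearP.
    by rewrite opprD addrACA -mulrBr mspanL.
  by rewrite mulrDl -mulrA piL.
- move=> c x y y'.
  rewrite /f [val (c *: y + y')](_ : _ = (c * val y + val y' : R)); last first.
    by rewrite linearP.
  by rewrite mulrDr mulrCA piL.
have fmon (x : submodule I) (y : submodule J) e k : E e -> F k ->
    val x = mon e -> val y = mon k ->
    f x y = if C e || ~~ fiber E F d e then pi (mon (e + k)%N) else pi 0.
  move=> Ee Fk xe yk; rewrite (monD mono); [|exact: EHs|exact: FHs].
  have [ie|ie] := boolP (C e || ~~ fiber E F d e).
    rewrite (fE _ _ (mon e)) ?yk // ?xe ?subrr ?mspan0 //.
    by apply: mspan_mon; rewrite /inner Ee.
  rewrite (fE _ _ 0) ?mul0r ?mspan0 // subr0 xe.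
  apply: mspan_mon; rewrite /outer Ee /=.
  by move: ie; rewrite negb_or => /andP[].
have pi0 : pi 0 = 0.
  by have := piL (-1) 0 0; rewrite mulr0 addr0 scaleN1r addNr.
exists Q, g; split => // x y e k Ee Fk xe yk.
  move=> lt; rewrite gp (fmon _ _ e k) //; case: ifP => // _; rewrite -pi0.
  apply/piE; rewrite subr0; apply: mspan_mon.
  have Hek : sgp a b (e + k) by apply: sgpD; [exact: EHs|exact: FHs].
  by rewrite /below Hek leqNgt lt.
move=> ekd; rewrite gp (fmon _ _ e k) // ekd.
have -> : fiber E F d e.
  by apply/and3P; split => //; [lia|have -> : (d - e = k)%N by lia].
rewrite orbF; case: (C e) => //; rewrite -pi0 => /piE; rewrite subr0.
move=> /(mspan_exp mono exponents_below)/andP.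
have Hek : sgp a b (e + k) by apply: sgpD; [exact: EHs|exact: FHs].
rewrite -{1}ekd => /(_ Hek)[_].
rewrite leqnn subnn /= => /negP; apply.
by apply/sgpP; exists 0%N, 0%N.
Qed.

End Degree.
End Functional.
End MonomialSpan.

Section MonomialIdeals.
Variables (R : idomainType) (a b : nat) (mon : nat -> R).
Hypotheses (a_gt1 : (1 < a)%N) (a_lt_b : (a < b)%N) (coprime_ab : coprime a b).
Hypothesis mono : monomials a b mon.

Lemma mspan_nonprincipal (I : submodClosed R^o) (E : pred nat) :
  exponents a b E -> I =i mspan mon E -> ~ principal I ->
  (exists e, E e) /\ nonprincipal a b E.
Proof.
move=> [EH EHs] IE nI; split.
  apply: contra_notP nI => E0; exists (0 : R^o) => x.
  apply/idP/idP; last first.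
    move: x; apply: submod_span_ind; first exact: rpred0.
      by move=> c x y xI yI; rewrite rpredD ?rpredZ.
    by move=> _ ->; exact: rpred0.
  rewrite IE; move: x; apply: mspan_ind; first exact: rpred0.
    by move=> c x y; exact: (@submod_spanL R R^o).
  by move=> n En; case: E0; exists n.
move=> g Eg; apply: contra_notP nI => nE; exists (mon g : R^o) => x.
have {}nE n : E n -> (g <= n)%N /\ sgp a b (n - g).
  move=> En; apply/andP; apply: contra_notT nE => nn.
  by exists n.
apply/idP/idP; last first.
  move: x; apply: submod_span_ind; first exact: rpred0.
    by move=> c x y xI yI; rewrite rpredD ?rpredZ.
  by move=> _ ->; rewrite IE mspan_mon.
rewrite IE; move: x; apply: mspan_ind; first exact: rpred0.
  by move=> c x y; exact: (@submod_spanL R R^o).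
move=> n En; have [le Hn] := nE n En.
rewrite -(subnK le) (monD mono) //; last exact: EHs.
by apply: (@rpredZ R R^o); exact: submod_span_gen.
Qed.

Lemma mu_monomial (I : submodClosed R^o) (E : pred nat) (s : seq nat) :
  exponents a b E -> I =i mspan mon E -> (forall g, (g \in s) = gen a b E g) ->
  ((0 : rat)%:E <= mu (submodule I))%E /\
  (mu (submodule I) <= ((size s)%:R : rat)%:E)%E.
Proof.
move=> [EH EHs] IE sE.
pose X n : submodule I := insubd (0 : submodule I) (mon n : R^o).
have XE n : E n -> val (X n) = mon n.
  by move=> En; apply: insubdK; rewrite IE mspan_mon.
rewrite -(size_map X); apply: mu_bounds => x.
suff [w wS wx] : exists2 w, w \in submod_span [set` map X s]%classic & val w = val x.
  by rewrite -(val_inj wx).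
have : (val x : R) \in mspan mon E by rewrite -IE; exact: valP.
move: (val x); apply: mspan_ind.
- by exists 0; [exact: rpred0|].
- move=> c u v [u' u'S <-] [v' v'S <-]; exists (c *: u' + v').
    exact: submod_spanL.
  by rewrite linearP.
move=> n En; have [g [h [gG Hh ->]]] := gen_decomp a_gt1 a_lt_b coprime_ab En.
have Eg : E g by case/and3P: gG.
exists (mon h *: X g).
  rewrite rpredZ //; apply: submod_span_gen => /=.
  by apply/mapP; exists g; rewrite ?sE.
by rewrite linearZ /= XE // addnC (monD mono) //; exact: EHs.
Qed.

(** Each splitting gives a torsion element.  In the order of decreasing degree,
    the map attached to a splitting kills the earlier elements: those of larger
    degree by degree reasons, those of the same degree because the splitting
    does not separate their two indices. *)
Theorem torsion_length_monomial (I J : submodClosed R^o) (E F : pred nat) :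
  exponents a b E -> exponents a b F -> I =i mspan mon E -> J =i mspan mon F ->
  ~ principal I -> ~ principal J ->
  ((2^-1 : rat)%:E * (mu (submodule I) * mu (submodule J)) <=
     module_length (submodule (torsion (tensor (submodule I) (submodule J)))))%E.
Proof.
move=> expE expF IE JF nI nJ.
have [[e0 Ee0] npE] := mspan_nonprincipal expE IE nI.
have [[f0 Ff0] npF] := mspan_nonprincipal expF JF nJ.
have [EH EHs] := expE; have [FH FHs] := expF.
have [gE gEu gEP] := gens_finite a_gt1 a_lt_b coprime_ab EH Ee0.
have [gF gFu gFP] := gens_finite a_gt1 a_lt_b coprime_ab FH Ff0.
have allE : all (gen a b E) gE by apply/allP => g; rewrite gEP.
have allF : all (gen a b F) gF by apply/allP => g; rewrite gFP.
have [L [s [Lu Lsize sval ssep]]] :=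
  splitting_family a_gt1 a_lt_b coprime_ab EH FH npE npF gEu gFu allE allF.
have [muI0 muI] := mu_monomial expE IE gEP.
have [muJ0 muJ] := mu_monomial expF JF gFP.
apply: (@le_trans _ _ ((size L)%:R : rat)%:E).
  apply: (@le_trans _ _ ((2^-1 : rat)%:E * ((size gE)%:R%:E * (size gF)%:R%:E))%E).
    by apply: lee_wpmul2l; [rewrite lee_fin invr_ge0|exact: lee_pmul].
  rewrite -!EFinM lee_fin mulrC ler_pdivrMr // -!natrM ler_nat.
  by rewrite muln2.
pose X n : submodule I := insubd (0 : submodule I) (mon n : R^o).
pose Y n : submodule J := insubd (0 : submodule J) (mon n : R^o).
have XE n : E n -> val (X n) = mon n.
  by move=> En; apply: insubdK; rewrite IE mspan_mon.
have YF n : F n -> val (Y n) = mon n.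
  by move=> Fn; apply: insubdK; rewrite JF mspan_mon.
pose pt d e := pure_tensor (X e) (Y (d - e)%N).
pose T := submodule (torsion (tensor (submodule I) (submodule J))).
pose tau p : T := insubd (0 : T) (pt (sdeg (s p)) (sfst (s p)) - pt (sdeg (s p)) (ssnd (s p))).
have tauE p : p \in L ->
    val (tau p) = pt (sdeg (s p)) (sfst (s p)) - pt (sdeg (s p)) (ssnd (s p)).
  move=> pL; apply: insubdK.
  have [/and3P[E1 le1 F1] /and3P[E2 le2 F2] _ _ _] := sval p pL.
  apply: torsion_pure_tensorB.
    by rewrite !XE // !YF // -!(monD mono) ?subnKC //; by [exact: EHs|exact: FHs].
  by rewrite XE // YF // mulf_neq0 // (mon_neq0 mono) //; by [exact: EHs|exact: FHs].
pose L' := sort (fun p q => (sdeg (s q) <= sdeg (s p))%N) L.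
have L'L p : (p \in L') = (p \in L) by rewrite mem_sort.
have L'u : uniq L' by rewrite sort_uniq.
have szL : size L' = size L by rewrite size_sort.
have L'sort : sorted (fun p q => (sdeg (s q) <= sdeg (s p))%N) L'.
  by apply: sort_sorted => p q; exact: leq_total.
rewrite -szL; apply: (module_length_ge (tau := fun i => tau (nth (0, 0)%N L' i))).
move=> i lt_i; set p := nth _ L' i.
have pL : p \in L by rewrite -L'L mem_nth.
have [S1 S2 C1 C2 sep] := sval p pL.
have [Q [g [gL ggt gd]]] := fiber_functional mono expE expF IE JF sep.
have g0 : g 0 = 0.
  have := gL (-1) 0 0; rewrite scaler0 addr0 scaleN1r => g0.
  by rewrite g0 addNr.
have gB z z' : g (z - z') = g z - g z'.
  by have := gL (-1) z' z; rewrite !scaleN1r addrC => ->; rewrite addrC.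
have gpt d e : fiber E F d e -> (sdeg (s p) < d)%N \/ (d = sdeg (s p) /\ ~~ spart (s p) e) ->
    g (pt d e) = 0.
  move=> /and3P[Ee le Fde] [lt|[dE Ce]].
    by apply: (ggt _ _ e (d - e)%N) => //; rewrite ?XE ?YF ?subnKC.
  have := gd (X e) (Y (d - e)%N) e (d - e)%N Ee Fde (XE _ Ee) (YF _ Fde).
  by rewrite subnKC // (negPf Ce) => /(_ dE).
exists (fun z : T => g (val z) = 0); split.
- by [].
- move=> c x y gx gy.
  by rewrite [val _](_ : _ = c *: val x + val y) ?gL ?gx ?gy ?scaler0 ?addr0 // linearP.
- move=> j lt_ji; set q := nth _ L' j.
  have lt_j : (j < size L')%N := ltn_trans lt_ji lt_i.
  have qL : q \in L by rewrite -L'L mem_nth.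
  have pq : p != q by rewrite nth_uniq // gtn_eqF.
  have [T1 T2 _ _ _] := sval q qL.
  have le : (sdeg (s p) <= sdeg (s q))%N.
    apply: (sorted_ltn_nth _ (0, 0)%N L'sort) => //.
    by move=> x y z /= yx zx; exact: leq_trans yx.
  have qq : (sdeg (s p) < sdeg (s q))%N \/ sdeg (s q) = sdeg (s p).
    by move: le; rewrite leq_eqVlt => /orP[/eqP|]; [right|left].
  rewrite tauE // gB; case: qq => [lt|qp].
    by rewrite !gpt ?subrr //; left.
  have /andP[N1 N2] := ssep p q pL qL pq (esym qp).
  by rewrite !gpt ?subrr //; right.
rewrite tauE // gB (gpt _ _ S2); last by right.
rewrite subr0; have /and3P[E1 le1 F1] := S1.
have := gd (X (sfst (s p))) (Y (sdeg (s p) - sfst (s p))%N) _ _ E1 F1 (XE _ E1) (YF _ F1).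
by rewrite subnKC // C1; apply.
Qed.

End MonomialIdeals.

Section Shift.
Variables (a b : nat).

Definition translate (k : nat) : pred nat := fun n => (k <= n)%N && sgp a b (n - k).

Variables (R : idomainType) (mon : nat -> R).

Lemma exponents_translate k : sgp a b k -> exponents a b (translate k).
Proof.
move=> Hk; split=> [n /andP[le Hn]|n /andP[le Hn]]; last first.
  by rewrite -(subnK le); exact: sgpD.
split; apply/andP; split; try by lia.
  have -> : (n + a - k = n - k + a)%N by lia.
  by apply: sgpD => //; exact: sgp_a.
have -> : (n + b - k = n - k + b)%N by lia.
by apply: sgpD => //; exact: sgp_b.
Qed.

Lemma sgp0 : sgp a b 0. Proof. by apply/sgpP; exists 0%N, 0%N. Qed.

Lemma translate_refl k : translate k k.
Proof. by rewrite /translate leqnn subnn sgp0. Qed.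

Hypotheses (a_gt1 : (1 < a)%N) (a_lt_b : (a < b)%N) (coprime_ab : coprime a b).
Hypothesis mono : monomials a b mon.

(** A generator is a power t^n, and n must be shown to lie in H: multiplied by the
    monomial of exponent ab, it becomes the monomial of exponent n + ab, which
    lies in the ideal generated by the monomial of exponent ab only if n is in
    H. *)
Lemma monomial_ideal_mspan (K : idomainType) (phi : R -> K) (t : K) (I : submodClosed R^o) :
  injective phi -> {morph phi : x y / x * y} ->
  (forall n, sgp a b n -> phi (mon n) = t ^+ n) ->
  monomial_ideal phi t I ->
  exists2 E, exponents a b E & I =i mspan mon E.
Proof.
move=> phi_inj phiM phi_mon [G Gt IG].
have gmon g : G g -> exists2 n, sgp a b n & g = mon n.
  move=> /Gt[n gn]; suff Hn : sgp a b n.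
    by exists n => //; apply: phi_inj; rewrite gn phi_mon.
  have Hk : sgp a b (a * b) by exact: sgp_conductor.
  have Hnk : sgp a b (n + a * b) by apply: sgp_conductor => //; exact: leq_addl.
  have gE : g * mon (a * b)%N = mon (n + a * b)%N.
    by apply: phi_inj; rewrite phiM gn !phi_mon // exprD.
  have : mon (n + a * b)%N \in mspan mon (translate (a * b)).
    by rewrite -gE mspanZ // mspan_mon // translate_refl.
  move=> /(mspan_exp mono (exponents_translate Hk) Hnk)/andP[_].
  by rewrite addnK.
exists (fun n => sgp a b n && (mon n \in I)).
  split=> [n /andP[Hn nI]|n /andP[]//].
  have step h : sgp a b h -> sgp a b (n + h) && (mon (n + h)%N \in I).
    move=> Hh; rewrite sgpD // (monD mono) // mulrC.
    exact: (@rpredZ R R^o).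
  by split; apply: step; [exact: sgp_a|exact: sgp_b].
move=> x; apply/idP/idP.
  rewrite IG; apply: submod_span_le => g Gg; have [n Hn gn] := gmon g Gg.
  apply: submod_span_gen; exists n => //=.
  rewrite Hn -gn IG; exact: submod_span_gen.
move: x; apply: mspan_ind.
- exact: rpred0.
- by move=> c x y xI yI; rewrite rpredD // (@rpredZ R R^o).
by move=> n /andP[].
Qed.

End Shift.

(** * The semigroup ring *)

Section SemigroupRing.
Variables (k : fieldType) (a b : nat).
Hypotheses (a_gt1 : (1 < a)%N) (a_lt_b : (a < b)%N) (coprime_ab : coprime a b).
Local Notation A := (semigroup_ring k a b).

Lemma supp_sgp (x : A) n : (val x)`_n != 0 -> sgp a b n.
Proof.
have /asboolP xP := valP x.
pose S : {pred {poly k}} := fun p => `[< forall n, p`_n != 0 -> sgp a b n >].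
have SE (p : {poly k}) : reflect (forall n, p`_n != 0 -> sgp a b n) (p \in S) by exact: asboolP.
have SX i : sgp a b i -> 'X^i \in S.
  move=> Hi; apply/SE => j; rewrite coefXn.
  by have [->|] := eqVneq j i; rewrite ?eqxx.
have SP : GRing.subalg_closed S.
  split; first by rewrite -(expr0 'X) SX // sgp0.
    move=> c p q /SE pS /SE qS; apply/SE => i; rewrite coefD coefZ.
    have [->|/pS//] := eqVneq p`_i 0; rewrite mulr0 add0r; exact: qS.
  move=> p q /SE pS /SE qS; apply/SE => i; rewrite coefM.
  apply: contraNT => Hi; rewrite big1 // => j _.
  have [->|/pS Hj] := eqVneq p`_j 0; first by rewrite mul0r.
  have [->|/qS Hj'] := eqVneq q`_(i - j) 0; first by rewrite mulr0.
  by case/negP: Hi; rewrite -(subnKC (leq_ord j)) sgpD.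
have /SE := xP S SP (SX _ (sgp_a a b)) (SX _ (sgp_b a b)).
by apply.
Qed.

Definition xmon n : A := insubd (0 : A) ('X^n : {poly k}).

Lemma val_xmon n : sgp a b n -> val (xmon n) = 'X^n.
Proof.
move=> /sgpP[p [q ->]]; apply: insubdK; apply/asboolP => S [S1 _ SM] Sa Sb.
have SXn i j : 'X^i \in S -> 'X^(j * i) \in S.
  move=> Si; elim: j => [|j IHj]; first by rewrite mul0n expr0.
  by rewrite mulSn exprD SM.
by rewrite exprD SM ?SXn.
Qed.

Lemma mspan_supp (X : pred nat) (x : A) n : exponents a b X ->
  x \in mspan xmon X -> (val x)`_n != 0 -> X n.
Proof.
move=> [XH XHs] xX; move: x xX n.
apply: (mspan_ind (P := fun x : A => forall n, (val x)`_n != 0 -> X n)).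
- by move=> n; rewrite coef0 eqxx.
- move=> c x y xX yX n; rewrite rmorphD rmorphM coefD coefM.
  have [->|/yX//] := eqVneq (val y)`_n 0; rewrite addr0.
  apply: contraNT => Xn; rewrite big1 // => j _.
  have [->|/supp_sgp Hj] := eqVneq (val c)`_j 0; first by rewrite mul0r.
  have [->|/xX Xj] := eqVneq (val x)`_(n - j) 0; first by rewrite mulr0.
  case/negP: Xn; rewrite -(subnK (leq_ord j)).
  exact: (hclosed_sgp XH).
move=> m Xm n; rewrite val_xmon ?XHs // coefXn.
by have [->|] := eqVneq n m; rewrite ?eqxx.
Qed.

Lemma supp_mspan (X : pred nat) (x : A) : (forall n, X n -> sgp a b n) ->
  (forall n, (val x)`_n != 0 -> X n) -> x \in mspan xmon X.
Proof.
move=> XHs xX.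
pose C (c : k) : A := insubd (0 : A) (c%:P : {poly k}).
have CE c : val (C c) = c%:P.
  apply: insubdK; have [S1 SL _] := subalg_gen_closed k a b.
  have S0 : (0 : {poly k}) \in subalg_gen a b by rewrite -(addNr 1) -scaleN1r SL.
  by rewrite -alg_polyC -[_ *: _]addr0 SL.
have -> : x = \sum_(i < size (val x)) (C (val x)`_i * xmon i).
  apply: val_inj; rewrite -[LHS]coefK poly_def rmorph_sum.
  apply: eq_bigr => i _; rewrite rmorphM /= CE mul_polyC.
  have [->|/xX/XHs Hi] := eqVneq (val x)`_i 0; first by rewrite !scale0r.
  by rewrite val_xmon.
apply: rpred_sum => i _.
have [c0|/xX Xi] := eqVneq (val x)`_i 0; last by rewrite mspanZ // mspan_mon.
have -> : C (val x)`_i = 0 by apply: val_inj; rewrite CE c0.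
by rewrite mul0r rpred0.
Qed.

Lemma monomials_xmon : monomials a b xmon.
Proof.
split=> [m n Hm Hn|X Y x eX eY xX xY|X n eX Hn xX].
- by apply: val_inj; rewrite rmorphM /= !val_xmon ?sgpD // exprD.
- apply: supp_mspan => [n /andP[/= Xn _]|n xn]; first by have [_] := eX; apply.
  by rewrite /= (mspan_supp eX xX xn) (mspan_supp eY xY xn).
by apply: (mspan_supp eX xX); rewrite val_xmon // coefXn eqxx oner_neq0.
Qed.

Lemma semigroup_ring_torsion (I J : submodClosed A^o) :
  monomial_ideal (val : A -> {poly k}) 'X I ->
  monomial_ideal (val : A -> {poly k}) 'X J ->
  ~ principal I -> ~ principal J ->
  ((2^-1 : rat)%:E * (mu (submodule I) * mu (submodule J)) <=
     module_length (submodule (torsion (tensor (submodule I) (submodule J)))))%E.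
Proof.
move=> mI mJ nI nJ.
have mid (L : submodClosed A^o) : monomial_ideal (val : A -> {poly k}) 'X L ->
    exists2 E, exponents a b E & L =i mspan xmon E.
  apply: (monomial_ideal_mspan a_gt1 a_lt_b coprime_ab monomials_xmon) => [x y|x y|n].
  - exact: val_inj.
  - by rewrite rmorphM.
  exact: val_xmon.
have [E eE IE] := mid I mI; have [F eF JF] := mid J mJ.
exact: (torsion_length_monomial a_gt1 a_lt_b coprime_ab monomials_xmon eE eF IE JF).
Qed.

End SemigroupRing.

(** * The local ring *)

(** A non-unit lies in a maximal ideal by Zorn's lemma.  The empty set is allowed
    among the candidates so that the empty chain has an upper bound. *)
Lemma local_ring_unit (R : comNzRingType) (m : idealr R) (x : R) :
  local_ring m -> x \notin m -> exists y, x * y = 1.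
Proof.
move=> [_ _ mU] xm; apply: contrapT => nx.
pose P (A : set R) := [/\ forall c u v, A u -> A v -> A (c * u + v), ~ A 1 &
  forall z, A z -> A x].
have [|A [[AL A1 Ax] Amax]] := @Zorn_bigcup R P.
  move=> F FP Ftot; split.
  - move=> c u v [A FA Au] [B FB Bv].
    have [AL _ _] := FP A FA; have [BL _ _] := FP B FB.
    have [AB|BA] := Ftot A B FA FB.
      by exists B => //; apply: BL => //; exact: AB.
    by exists A => //; apply: AL => //; exact: BA.
  - by move=> [A FA]; have [] := FP A FA.
  by move=> z [A FA Az]; have [_ _ Ax] := FP A FA; exists A => //; exact: Ax Az.
have xA : A x.
  apply: contrapT => NAx.
  have A0 z : ~ A z by move=> /Ax.
  apply: (Amax [set x * y | y in setT]%classic).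
    split; first by move=> z /A0.
    by move=> /(_ x) H; apply: NAx; apply: H; exists 1; rewrite ?mulr1.
  split.
  - move=> c _ _ [u _ <-] [v _ <-]; exists (c * u + v) => //.
    by rewrite mulrDr mulrCA.
  - by move=> [y _ y1]; apply: nx; exists y.
  by move=> _ _; exists 1; rewrite ?mulr1.
pose S : {pred R} := fun z => `[< A z >].
have SE z : reflect (A z) (z \in S) by exact: asboolP.
have SP : idealr_closed S.
  split; first by apply/SE; have := AL (-1) x x xA xA; rewrite mulN1r addNr.
    by apply/SE.
  by move=> c u v /SE Au /SE Av; apply/SE; exact: AL.
pose n : idealr R := HB.pack S (isIdealr.Build R S SP).
have nmax : maximal_ideal n.
  move=> J nJ z zJ; apply/SE; apply: contrapT => NAz.
  apply: (Amax [set z | z \in J]%classic).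
    split; first by move=> y Ay; apply: nJ; exact/SE.
    by move=> /(_ z zJ).
  split=> [c u v uJ vJ|/= |y _ /=].
  - by rewrite /= rpredD // idealMr.
  - by rewrite idealr1.
  by apply: nJ; exact/SE.
by case/negP: xm; rewrite -(mU n nmax); exact/SE.
Qed.

(** If w = 1 / u is a root of a monic polynomial of degree n over R, multiplying
    the equation by u^n expresses 1 as a multiple of u. *)
Lemma integral_inverse (R : idomainType) (u : R) (w : {fraction R}) :
  integralOver (@tofrac R) w -> tofrac u * w = 1 -> exists c, c * u = 1.
Proof.
move=> [p p_monic /rootP pw] uw.
set n := (size p).-1.
have sp : size p = n.+1 by rewrite prednK // size_poly_gt0 monic_neq0.
have E : \sum_(i < n.+1) p`_i * u ^+ (n - i) = 0.
  apply/eqP; rewrite -tofrac_eq0; apply/eqP.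
  have <- : tofrac u ^+ n * (map_poly (@tofrac R) p).[w] = 0 by rewrite pw mulr0.
  rewrite horner_coef size_map_poly_id0; last first.
    by rewrite tofrac_eq0 lead_coef_eq0 monic_neq0.
  rewrite sp mulr_sumr rmorph_sum; apply: eq_bigr => i _ /=.
  rewrite coef_map /= rmorphM rmorphXn /= mulrCA; congr (_ * _).
  have -> : tofrac u ^+ n = tofrac u ^+ (n - i) * tofrac u ^+ i.
    by rewrite -exprD subnK // -ltnS.
  by rewrite -mulrA -exprMn uw expr1n mulr1.
move: E; rewrite big_ord_recr /= subnn expr0 mulr1.
have -> : p`_n = 1 by have /monicP := p_monic; rewrite lead_coefE.
move=> /eqP; rewrite addr_eq0 => /eqP E.
exists (- \sum_(i < n) p`_i * u ^+ (n - i).-1).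
rewrite mulNr mulr_suml -[RHS]opprK -E; congr (- _); apply: eq_bigr => i _.
by rewrite -mulrA -exprSr prednK // subn_gt0.
Qed.

Section Local.
Variables (R : idomainType) (m : idealr R) (a b : nat) (t : {fraction R}) (u v : R).
Hypotheses (a_gt1 : (1 < a)%N) (a_lt_b : (a < b)%N) (coprime_ab : coprime a b).
Hypothesis unit_notin : forall x, x \notin m -> exists y, x * y = 1.
Hypotheses (t_int : integralOver (@tofrac R) t) (t_neq0 : t != 0).
Hypotheses (ut : tofrac u = t ^+ a) (vt : tofrac v = t ^+ b).
Hypothesis mE : m =i submod_span [set (u : R^o); (v : R^o)]%classic.

Definition tmon n : R := xget 0 [set x | tofrac x = t ^+ n]%classic.

Lemma tofrac_tmon n : sgp a b n -> tofrac (tmon n) = t ^+ n.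
Proof.
move=> /sgpP[p [q ->]].
apply: (@xgetPex _ 0 [set x | tofrac x = t ^+ (p * a + q * b)]%classic).
exists (u ^+ p * v ^+ q) => /=.
by rewrite rmorphM !rmorphXn /= ut vt -!exprM -exprD ![(_ * p)%N]mulnC ![(_ * q)%N]mulnC.
Qed.

Lemma tofrac_injective : injective (@tofrac R).
Proof. by move=> x y /eqP; rewrite tofrac_eq => /eqP. Qed.

Lemma tmonD k n : sgp a b k -> sgp a b n -> tmon (k + n) = tmon k * tmon n.
Proof.
move=> Hk Hn; apply: tofrac_injective.
by rewrite rmorphM /= !tofrac_tmon ?sgpD // exprD.
Qed.

Lemma u_in_m : u \in m.
Proof. by rewrite mE; apply: submod_span_gen; left. Qed.

Local Notation mspan := (mspan tmon).

(** Dividing a relation c t^n = sum of r_i t^i with i > n by t^n shows that the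
    unit c is t times an integral element, so t and u = t^a have integral
    inverses; then u is a unit, although it lies in m. *)
Lemma leading_unit (X : pred nat) n c : c \notin m -> sgp a b n ->
  (forall i, X i -> sgp a b i /\ (n < i)%N) -> c * tmon n \in mspan X -> False.
Proof.
move=> cm Hn XP cX; have [d cd] := unit_notin cm.
have [y y_int] : exists2 y, integralOver (@tofrac R) y &
    tofrac (c * tmon n) = t ^+ n.+1 * y.
  move: (c * tmon n) cX; apply: mspan_ind.
  - by exists 0; [exact: integral0|rewrite rmorph0 mulr0].
  - move=> e x y [x' x'i xE] [y' y'i yE]; exists (tofrac e * x' + y').
      exact: integral_add (integral_mul (integral_id (@tofrac R) e) x'i) y'i.
    by rewrite rmorphD rmorphM /= xE yE mulrDr mulrCA.
  move=> i /XP[Hi lt]; exists (t ^+ (i - n.+1)).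
    elim: (i - n.+1)%N => [|j IHj]; first by rewrite expr0; exact: integral1.
    by rewrite exprS; exact: integral_mul t_int IHj.
  by rewrite tofrac_tmon // -exprD subnKC.
rewrite rmorphM /= tofrac_tmon // exprSr -mulrA mulrC => /mulfI.
rewrite expf_neq0 // => /(_ isT) cy.
have t1 : t * (y * tofrac d) = 1 by rewrite mulrA -cy -rmorphM cd rmorph1.
have w_int : integralOver (@tofrac R) ((y * tofrac d) ^+ a).
  elim: (a) => [|j IHj]; first by rewrite expr0; exact: integral1.
  rewrite exprS.
  exact: integral_mul (integral_mul y_int (integral_id (@tofrac R) d)) IHj.
have [e eu] : exists e, e * u = 1.
  by apply: (integral_inverse w_int); rewrite ut -exprMn t1 expr1n.
by have := idealMr e u_in_m; rewrite eu idealr1.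
Qed.

Definition tail (X : pred nat) N : pred nat := fun n => X n && (N <= n)%N.

Lemma ideal_mul_tail X N r : exponents a b X -> X N -> r \in m ->
  r * tmon N \in mspan (tail X N.+1).
Proof.
move=> [XH XHs] XN; have [Xa Xb] := XH N XN.
have uE : u = tmon a by apply: tofrac_injective; rewrite tofrac_tmon ?ut //; exact: sgp_a.
have vE : v = tmon b by apply: tofrac_injective; rewrite tofrac_tmon ?vt //; exact: sgp_b.
rewrite mE; move: r; apply: (@submod_span_ind R R^o).
- by rewrite mul0r mspan0.
- by move=> c x y xP yP; rewrite mulrDl -mulrA mspanL.
move=> _ [] ->; rewrite ?uE ?vE mulrC -tmonD ?sgp_a ?sgp_b //; try exact: XHs.
  by apply: mspan_mon; rewrite /tail Xa /=; lia.
by apply: mspan_mon; rewrite /tail Xb /=; lia.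
Qed.

(** A coefficient in m = (t^a, t^b) is absorbed in higher monomials, so the
    coefficient at N can be taken to be zero or a unit. *)
Lemma leading_term X N x : exponents a b X -> x \in mspan (tail X N) ->
  exists c, (c = 0 \/ c \notin m /\ X N) /\ x - c * tmon N \in mspan (tail X N.+1).
Proof.
move=> eX xX.
have [r [rX xr]] : exists r, (r = 0 \/ X N) /\ x - r * tmon N \in mspan (tail X N.+1).
  move: x xX; apply: mspan_ind.
  - by exists 0; split; [left|rewrite mul0r subr0 mspan0].
  - move=> c x y [r [rX xr]] [s [sX ys]]; exists (c * r + s); split.
      case: rX => [->|]; last by right.
      by case: sX => [->|]; [left; rewrite mulr0 addr0|right].
    by rewrite mulrDl opprD addrACA -mulrA -mulrBr mspanL.
  move=> n /andP[Xn le]; have [<-|nN] := eqVneq n N.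
    by exists 1; split; [right|rewrite mul1r subrr mspan0].
  exists 0; split; [by left|rewrite mul0r subr0 mspan_mon // /tail Xn].
  by rewrite ltn_neqAle eq_sym nN.
have [rm|rm] := boolP (r \in m); last first.
  exists r; split => //; case: rX => [r0|]; last by right.
  by left.
exists 0; split; first by left.
rewrite mul0r subr0 -(subrK (r * tmon N) x) mspanD //.
by case: rX => [->|XN]; [rewrite mul0r mspan0|exact: ideal_mul_tail].
Qed.

(** An element of both spans is approximated from the common exponents to any
    order N: by [leading_unit] its leading coefficients with respect to X and to Y
    agree modulo m, so N is a common exponent as soon as they do not vanish.
    Past the conductor of H every exponent is common. *)
Lemma tmspan_cap X Y x : exponents a b X -> exponents a b Y ->
  x \in mspan X -> x \in mspan Y -> x \in mspan (predI X Y).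
Proof.
move=> eX eY xX xY; have [XH XHs] := eX; have [YH YHs] := eY.
have [[e Xe]|X0] := pselect (exists e, X e); last first.
  by apply: mspan_sub xX => n Xn; case: X0; exists n.
have [[f Yf]|Y0] := pselect (exists f, Y f); last first.
  by apply: mspan_sub xY => n Yn; case: Y0; exists n.
have approx N : exists z, [/\ z \in mspan (predI X Y),
    x - z \in mspan (tail X N) & x - z \in mspan (tail Y N)].
  elim: N => [|N [z [zXY xzX xzY]]].
    by exists 0; rewrite subr0 mspan0; split => //;
      [apply: mspan_sub xX|apply: mspan_sub xY] => n Hn; rewrite /tail Hn.
  have [c [cP xc]] := leading_term eX xzX.
  have [d [dP xd]] := leading_term eY xzY.
  have cdm : sgp a b N -> c - d \in m.
    move=> HN; apply/negPn/negP => cd.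
    apply: (@leading_unit (tail (sgp a b) N.+1) N (c - d)) => // [i /andP[]//|].
    have -> : (c - d) * tmon N = x - z - d * tmon N - (x - z - c * tmon N).
      by rewrite opprB [_ - z - _]addrC addrCA addrK mulrBl addrC.
    by apply: mspanB; [apply: mspan_sub xd|apply: mspan_sub xc] => n /andP[+ nN];
      rewrite /tail nN andbT; [exact: YHs|exact: XHs].
  case: cP dP cdm xc xd => [->|[cm XN]] [->|[dm YN]] cdm xc xd.
  - by exists z; rewrite !mul0r !subr0 in xc xd *.
  - by case/negP: dm; rewrite -(opprK d) rpredN -(sub0r d) cdm ?YHs.
  - by case/negP: cm; rewrite -(subr0 c) cdm ?XHs.
  exists (z + c * tmon N); rewrite opprD addrA; split=> //.
    by rewrite mspanD // mspanZ // mspan_mon //= XN YN.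
  have -> : x - z - c * tmon N = x - z - d * tmon N - (c - d) * tmon N.
    by rewrite mulrBl opprB addrA subrK.
  by apply: mspanB => //; apply: ideal_mul_tail => //; apply: cdm; exact: XHs.
have [z [zXY xz _]] := approx (e + f + a * b)%N.
rewrite -(subrK z x) mspanD //; apply: mspan_sub xz => n /andP[Xn le].
apply/andP; split => //=.
have -> : n = (f + (n - f))%N by lia.
by apply: (hclosed_sgp YH) => //; apply: sgp_conductor => //; lia.
Qed.

Lemma tmspan_exp X n : exponents a b X -> sgp a b n -> tmon n \in mspan X -> X n.
Proof.
move=> eX Hn nX; apply/negPn/negP => NXn.
have nT : tmon n \in mspan (translate a b n) by rewrite mspan_mon // translate_refl.
have nC := tmspan_cap eX (exponents_translate Hn) nX nT.
apply: (@leading_unit (predI X (translate a b n)) n 1); rewrite ?mul1r ?idealr1 //.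
move=> i /andP[/= Xi /andP[ni _]]; split; first by have [_] := eX; apply.
by rewrite ltn_neqAle ni andbT; apply: contra NXn => /eqP ->.
Qed.

Lemma monomials_tmon : monomials a b tmon.
Proof.
by split; [exact: tmonD|exact: tmspan_cap|exact: tmspan_exp].
Qed.

Lemma local_ring_torsion (I J : submodClosed R^o) :
  monomial_ideal (@tofrac R) t I -> monomial_ideal (@tofrac R) t J ->
  ~ principal I -> ~ principal J ->
  ((2^-1 : rat)%:E * (mu (submodule I) * mu (submodule J)) <=
     module_length (submodule (torsion (tensor (submodule I) (submodule J)))))%E.
Proof.
move=> mI mJ nI nJ.
have mid (L : submodClosed R^o) : monomial_ideal (@tofrac R) t L ->
    exists2 E, exponents a b E & L =i mspan E.
  apply: (monomial_ideal_mspan a_gt1 a_lt_b coprime_ab monomials_tmon) => [|x y|n].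
  - exact: tofrac_injective.
  - by rewrite rmorphM.
  exact: tofrac_tmon.
have [E eE IE] := mid I mI; have [F eF JF] := mid J mJ.
exact: (torsion_length_monomial a_gt1 a_lt_b coprime_ab monomials_tmon eE eF IE JF).
Qed.
End Local.

Lemma field_principal (R : comNzRingType) (I : submodClosed R^o) :
  (forall x : R, x != 0 -> exists y, x * y = 1) -> principal I.
Proof.
move=> inv; have [[x xI x0]|I0] := pselect (exists2 x : R, x \in I & x != 0).
  have I1 : (1 : R) \in I.
    by have [y <-] := inv x x0; rewrite mulrC; exact: (@rpredZ R R^o).
  exists (1 : R^o) => z; rewrite -[z]mulr1.
  transitivity true; last apply/esym; apply: (@rpredZ R R^o) => //.
  exact: submod_span_gen.
exists (0 : R^o) => z; apply/idP/idP => [zI|].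
  have [->|z0] := eqVneq z 0; first exact: rpred0.
  by case: I0; exists z.
move: z; apply: submod_span_ind; first exact: rpred0.
  by move=> c x y xI yI; rewrite rpredD ?rpredZ.
by move=> _ ->; exact: rpred0.
Qed.

Theorem corollary3p9 (a b : nat) (a_gt1 : (1 < a)%N) (a_lt_b : (a < b)%N)
    (coprime_ab : coprime a b) :
  (forall (k : fieldType) (I J : submodClosed (semigroup_ring k a b)^o),
     monomial_ideal (val : semigroup_ring k a b -> {poly k}) 'X I ->
     monomial_ideal (val : semigroup_ring k a b -> {poly k}) 'X J ->
     ~ principal I -> ~ principal J ->
     ((2^-1 : rat)%:E * (mu (submodule I) * mu (submodule J)) <=
        module_length
          (submodule (torsion (tensor (submodule I) (submodule J)))))%E)
  /\
  (forall (R' : idomainType) (m : idealr R') (t : integral_closure R'),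
     analytically_irreducible m ->
     krull_dim R' = 1%:E ->
     residually_rational m ->
     (exists u v : R',
        [/\ tofrac u = val t ^+ a, tofrac v = val t ^+ b &
            m =i submod_span [set (u : R'^o); (v : R'^o)]%classic]) ->
   forall I' J' : submodClosed R'^o,
     monomial_ideal (@tofrac R') (val t) I' ->
     monomial_ideal (@tofrac R') (val t) J' ->
     ~ principal I' -> ~ principal J' ->
     ((2^-1 : rat)%:E * (mu (submodule I') * mu (submodule J')) <=
        module_length
          (submodule (torsion (tensor (submodule I') (submodule J')))))%E).
Proof.
split=> [k I J|R m t [m_local _] _ _ [u [v [ut vt mE]]] I J mI mJ nI nJ].
  exact: semigroup_ring_torsion.
have unit_notin x : x \notin m -> exists y, x * y = 1 by exact: local_ring_unit.
have [t0|t_neq0] := eqVneq (val t) 0; last first.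
  have /asboolP t_int : val t \in @integral R by exact: valP.
  exact: (local_ring_torsion a_gt1 a_lt_b coprime_ab unit_notin t_int t_neq0
    ut vt mE mI mJ nI nJ).
(* If t = 0 then m = 0, so that R' is a field and its ideals are principal. *)
case: nI; apply: field_principal => x x0; apply: unit_notin.
apply: contra x0; rewrite mE => xm; apply/eqP.
move: x xm; apply: (submod_span_ind (P := fun x : R^o => x = 0)) => //.
  by move=> c x y -> ->; rewrite scaler0 addr0.
have z0 n (w : R) : (1 < n)%N -> tofrac w = val t ^+ n -> w = 0.
  move=> n1; rewrite t0 expr0n gtn_eqF ?(ltnW n1) // => /eqP.
  by rewrite tofrac_eq0 => /eqP.
by move=> _ [] ->; [exact: z0 ut|exact: z0 (ltn_trans a_gt1 a_lt_b) vt].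
Qed.
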